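(* The set $\mathrm{DEF}$ of (Gödel codes of) definitions of truth for $\mathcal{L}_A$ is not $\Sigma_2$-definable in the standard model of arithmetic $\mathbb{N}$; that is, there is no $\Sigma_2$ formula $\sigma(x)$ of $\mathcal{L}_A$ such that for every $n\in\omega$: $\mathbb{N}\models\sigma(n)$ if and only if $n$ is the Gödel code of a sentence in $\mathrm{DEF}$.
   Context: $\mathcal{L}_A$ is the first-order language with equality of signature $\langle 0,1,+,\times,<\rangle$. $\mathrm{EA}$ is (a fixed finite axiomatization of) the theory $\mathrm{PA}^-$ (nonnegative parts of discretely ordered rings) + induction for $\Delta_0$ formulae + totality of exponentiation. All languages considered extend $\mathcal{L}_A$ by finitely many relation symbols (with a fixed Gödel coding $\ulcorner\cdot\urcorner$ of all such formulae). A theory of truth for $\mathcal{L}_A$ is a consistent theory $Th$ containing $\mathrm{EA}$ for which there is a formula $\Theta(x)$ of its language with one free variable such that $Th\vdash\Theta(\ulcorner\sigma\urcorner)\leftrightarrow\sigma$ for every $\mathcal{L}_A$-sentence $\sigma$. A definition of truth for $\mathcal{L}_A$ is a finitely axiomatizable theory of truth for $\mathcal{L}_A$, identified with a single sentence axiomatizing it. $\mathrm{DEF}$ is the set of definitions of truth for $\mathcal{L}_A$. *)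

(* Defs.v *)
From mathcomp Require Import all_boot.
From Stdlib Require List.
Set Implicit Arguments.
Unset Strict Implicit.
Unset Printing Implicit Defensive.

(** * Syntax *)

(** Terms and formulae are in de Bruijn style.  The function symbols are those
    of L_A; relation symbols beyond [=] and [<] come from a countable supply
    with infinitely many symbols of every arity. *)
Inductive term : Type :=
| tVar of nat
| tZero
| tOne
| tAdd of term & term
| tMul of term & term.

(** [fRel i ts] applies the relation symbol of index [i] and arity [size ts]:
    a relation symbol is a pair (index, arity), and arities always match. *)
Inductive form : Type :=
| fBot
| fEq of term & term
| fLt of term & term
| fRel of nat & seq term
| fImp of form & form
| fAll of form.

Definition fNot (A : form) : form := fImp A fBot.
Definition fAnd (A B : form) : form := fNot (fImp A (fNot B)).
Definition fOr (A B : form) : form := fImp (fNot A) B.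
Definition fIff (A B : form) : form := fAnd (fImp A B) (fImp B A).
Definition fEx (A : form) : form := fNot (fAll (fNot A)).
Definition fLe (s t : term) : form := fOr (fLt s t) (fEq s t).
Definition fAlls (k : nat) (A : form) : form := iter k fAll A.

Definition scons {T : Type} (t : T) (s : nat -> T) (n : nat) : T :=
  if n is m.+1 then s m else t.

Fixpoint tsubst (s : nat -> term) (t : term) : term :=
  match t with
  | tVar n => s n
  | tZero => tZero
  | tOne => tOne
  | tAdd t1 t2 => tAdd (tsubst s t1) (tsubst s t2)
  | tMul t1 t2 => tMul (tsubst s t1) (tsubst s t2)
  end.

Definition tshift : term -> term := tsubst (fun n => tVar n.+1).

Definition up (s : nat -> term) : nat -> term :=
  scons (tVar 0) (fun n => tshift (s n)).

Fixpoint subst (s : nat -> term) (A : form) : form :=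
  match A with
  | fBot => fBot
  | fEq t1 t2 => fEq (tsubst s t1) (tsubst s t2)
  | fLt t1 t2 => fLt (tsubst s t1) (tsubst s t2)
  | fRel i ts => fRel i (map (tsubst s) ts)
  | fImp B C => fImp (subst s B) (subst s C)
  | fAll B => fAll (subst (up s) B)
  end.

Definition shift : form -> form := subst (fun n => tVar n.+1).

(** Instantiation of variable 0, the remaining variables being lowered. *)
Definition inst (A : form) (t : term) : form := subst (scons t tVar) A.

(** A language is a finite list of relation symbols (index, arity) added to
    L_A. *)
Definition language : Type := seq (nat * nat).
Definition L_A : language := [::].

Fixpoint term_below (k : nat) (t : term) : bool :=
  match t with
  | tVar n => n < k
  | tZero | tOne => true
  | tAdd t1 t2 | tMul t1 t2 => term_below k t1 && term_below k t2
  end.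

(** [formula_of L k A]: [A] is a formula of the language [L] whose free
    variables are among 0, ..., k-1. *)
Fixpoint formula_of (L : language) (k : nat) (A : form) : bool :=
  match A with
  | fBot => true
  | fEq t1 t2 | fLt t1 t2 => term_below k t1 && term_below k t2
  | fRel i ts => ((i, size ts) \in L) && all (term_below k) ts
  | fImp B C => formula_of L k B && formula_of L k C
  | fAll B => formula_of L k.+1 B
  end.

Definition sentence_of (L : language) (A : form) : bool := formula_of L 0 A.

(** * Goedel coding *)

(** An injective polynomial pairing: [(x + y) ^ 2 <= npair x y < (x + y).+1 ^ 2].
    It is not onto, so not every number is a code. *)
Definition npair (x y : nat) : nat := (x + y) ^ 2 + x.

Fixpoint code_term (t : term) : nat :=
  match t with
  | tVar n => npair 0 n
  | tZero => npair 1 0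
  | tOne => npair 2 0
  | tAdd t1 t2 => npair 3 (npair (code_term t1) (code_term t2))
  | tMul t1 t2 => npair 4 (npair (code_term t1) (code_term t2))
  end.

Definition code_terms (ts : seq term) : nat :=
  foldr (fun t c => (npair (code_term t) c).+1) 0 ts.

Fixpoint code (A : form) : nat :=
  match A with
  | fBot => npair 0 0
  | fEq t1 t2 => npair 1 (npair (code_term t1) (code_term t2))
  | fLt t1 t2 => npair 2 (npair (code_term t1) (code_term t2))
  | fRel i ts => npair 3 (npair i (code_terms ts))
  | fImp B C => npair 4 (npair (code B) (code C))
  | fAll B => npair 5 (code B)
  end.

Fixpoint numeral (n : nat) : term :=
  if n is m.+1 then tAdd (numeral m) tOne else tZero.

(** * Provability *)

(** Classical natural deduction with equality. *)
Inductive derives : seq form -> form -> Prop :=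
| D_hyp G A : List.In A G -> derives G A
| D_impI G A B : derives (A :: G) B -> derives G (fImp A B)
| D_impE G A B : derives G (fImp A B) -> derives G A -> derives G B
| D_raa G A : derives (fNot A :: G) fBot -> derives G A
| D_allI G A : derives (map shift G) A -> derives G (fAll A)
| D_allE G A t : derives G (fAll A) -> derives G (inst A t)
| D_eqI G t : derives G (fEq t t)
| D_eqE G A s t : derives G (fEq s t) -> derives G (inst A s) ->
    derives G (inst A t).

Definition proves (Th : form -> Prop) (A : form) : Prop :=
  exists G : seq form, (forall B, List.In B G -> Th B) /\ derives G A.

Definition consistent (Th : form -> Prop) : Prop := ~ proves Th fBot.

(** * Arithmetical hierarchy *)

Definition fBAll (t : term) (A : form) : form :=
  fAll (fImp (fLt (tVar 0) (tshift t)) A).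

(** Bounded existential quantifiers are obtained through negation. *)
Inductive Delta0 : form -> Prop :=
| Delta0_bot : Delta0 fBot
| Delta0_eq s t : Delta0 (fEq s t)
| Delta0_lt s t : Delta0 (fLt s t)
| Delta0_rel i ts : Delta0 (fRel i ts)
| Delta0_imp A B : Delta0 A -> Delta0 B -> Delta0 (fImp A B)
| Delta0_ball t A : Delta0 A -> Delta0 (fBAll t A).

Inductive Sigma : nat -> form -> Prop :=
| Sigma_0 A : Delta0 A -> Sigma 0 A
| Sigma_Pi n A : Pi n A -> Sigma n.+1 A
| Sigma_ex n A : Sigma n.+1 A -> Sigma n.+1 (fEx A)
with Pi : nat -> form -> Prop :=
| Pi_0 A : Delta0 A -> Pi 0 A
| Pi_Sigma n A : Sigma n A -> Pi n.+1 A
| Pi_all n A : Pi n.+1 A -> Pi n.+1 (fAll A).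

(** * Elementary arithmetic *)

Declare Scope fol_scope.
Local Open Scope fol_scope.
Local Notation "' n" := (tVar n) (at level 1, n at level 0, format "' n") : fol_scope.
Local Infix "[+]" := tAdd (at level 50, left associativity) : fol_scope.
Local Infix "[*]" := tMul (at level 40, left associativity) : fol_scope.
Local Infix "[=]" := fEq (at level 70) : fol_scope.
Local Infix "[<]" := fLt (at level 70) : fol_scope.
Local Infix "[<=]" := fLe (at level 70) : fol_scope.
Local Infix "[&]" := fAnd (at level 80, right associativity) : fol_scope.
Local Infix "[|]" := fOr (at level 85, right associativity) : fol_scope.
Local Infix "[->]" := fImp (at level 90, right associativity) : fol_scope.

Definition PAminus : seq form :=
  [:: fAlls 3 ('0 [+] '1 [+] '2 [=] '0 [+] ('1 [+] '2));
      fAlls 2 ('0 [+] '1 [=] '1 [+] '0);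
      fAlls 3 ('0 [*] '1 [*] '2 [=] '0 [*] ('1 [*] '2));
      fAlls 2 ('0 [*] '1 [=] '1 [*] '0);
      fAlls 3 ('0 [*] ('1 [+] '2) [=] '0 [*] '1 [+] '0 [*] '2);
      fAlls 1 ('0 [+] tZero [=] '0);
      fAlls 1 ('0 [*] tZero [=] tZero);
      fAlls 1 ('0 [*] tOne [=] '0);
      fAlls 3 ('0 [<] '1 [->] '1 [<] '2 [->] '0 [<] '2);
      fAlls 1 (fNot ('0 [<] '0));
      fAlls 2 ('0 [<] '1 [|] '0 [=] '1 [|] '1 [<] '0);
      fAlls 3 ('0 [<] '1 [->] '0 [+] '2 [<] '1 [+] '2);
      fAlls 3 (tZero [<] '2 [->] '0 [<] '1 [->] '0 [*] '2 [<] '1 [*] '2);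
      fAlls 2 ('0 [<] '1 [->] fEx ('1 [+] '0 [=] '2));
      tZero [<] tOne;
      fAlls 1 (tZero [<] '0 [->] tOne [<=] '0);
      fAlls 1 (tZero [<=] '0)].

(** Induction on variable 0; the others are parameters. *)
Definition induction_for (A : form) : form :=
  inst A tZero
  [->] fAll (A [->] subst (scons ('0 [+] tOne) (fun n => tVar n.+1)) A)
  [->] fAll A.

(** Goedel's beta function: [u] is the remainder of [a] modulo
    [1 + (i + 1) * b]. *)
Definition fBeta (a b i u : term) : form :=
  let m i b := tOne [+] (i [+] tOne) [*] b in
  u [<] m i b
  [&] fEx (tshift a [=] '0 [*] m (tshift i) (tshift b) [+] tshift u).

(** For all x, y there are z and a beta-code (a, b) of a sequence starting with
    1, multiplied by x at each of y steps, and ending with z. *)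
Definition exp_total : form :=
  fAll (* x *) (fAll (* y *) (fEx (* z *) (fEx (* a *) (fEx (* b *)
    (fBeta '1 '0 tZero tOne
     [&] fBAll '3 (* i < y *) (fEx (* u *)
           (fBeta '3 '2 '1 '0 [&] fBeta '3 '2 ('1 [+] tOne) ('0 [*] '6)))
     [&] fBeta '1 '0 '3 '2))))).

(** Induction axioms are the universal closures over the parameters. *)
Inductive EA : form -> Prop :=
| EA_PAminus A : List.In A PAminus -> EA A
| EA_induction k A : Delta0 A -> formula_of L_A k.+1 A ->
    EA (fAlls k (induction_for A))
| EA_exp : EA exp_total.

(** * Semantics *)

Record structure : Type := Structure {
  dom : Type;
  i_zero : dom;
  i_one : dom;
  i_add : dom -> dom -> dom;
  i_mul : dom -> dom -> dom;
  i_lt : dom -> dom -> Prop;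
  i_rel : nat -> seq dom -> Prop
}.

Fixpoint eval (M : structure) (v : nat -> dom M) (t : term) : dom M :=
  match t with
  | tVar n => v n
  | tZero => i_zero M
  | tOne => i_one M
  | tAdd t1 t2 => i_add (eval v t1) (eval v t2)
  | tMul t1 t2 => i_mul (eval v t1) (eval v t2)
  end.

Fixpoint sat (M : structure) (v : nat -> dom M) (A : form) : Prop :=
  match A with
  | fBot => False
  | fEq t1 t2 => eval v t1 = eval v t2
  | fLt t1 t2 => i_lt (eval v t1) (eval v t2)
  | fRel i ts => i_rel i (map (eval v) ts)
  | fImp B C => sat v B -> sat v C
  | fAll B => forall d : dom M, sat (scons d v) B
  end.

(** The interpretation of the additional symbols is a dummy: the standard model
    is only used for formulae of L_A. *)
Definition std_model : structure :=
  @Structure nat 0 1 addn muln (fun m n => m < n) (fun _ _ => False).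

(** * Definitions of truth *)

Definition extends_EA (Th : form -> Prop) : Prop :=
  forall A, EA A -> proves Th A.

(** [Th] is a theory of truth for L_A in the language [L]. *)
Definition theory_of_truth (L : language) (Th : form -> Prop) : Prop :=
  [/\ forall A, Th A -> sentence_of L A,
      consistent Th,
      extends_EA Th
    & exists2 Theta : form, formula_of L 1 Theta &
        forall A, sentence_of L_A A ->
          proves Th (fIff (inst Theta (numeral (code A))) A)].

Definition DEF (A : form) : Prop :=
  exists L : language, theory_of_truth L (fun B => B = A).

(* Main.v *)
From Stdlib Require Import Classical ClassicalEpsilon FunctionalExtensionality PropExtensionality ProofIrrelevance.
From Stdlib Require List.
Require Import Defs.
From mathcomp Require Import all_boot zify.
Set Implicit Arguments.
Unset Strict Implicit.
Unset Printing Implicit Defensive.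

(** Suppose a Sigma_2 formula [sigma] defines DEF, and write its negation as
    "for all c, g(c, n)", where [g] is decreasing in [c], upward absolute from N
    to the models of PA^-, and [g(c, n)] bounds the outer existential
    quantifiers of [sigma] by [c].  By diagonalisation there is a sentence [A]
    which adds to PA^- and the totality of exponentiation a binary satisfaction
    predicate obeying full induction, whose Tarskian clause for the formula
    with code [c] is only required when [g(c, code A)] holds.

    If [sigma] fails at [code A], all the guards hold and all standard codes
    pass them in every model of [A], so that [A] proves every T-biconditional
    and the induction axioms, while N with its true satisfaction relation is a
    model of [A]; thus [A] is in DEF.  If [sigma] holds at [code A], only codes
    below some [c0] pass the guard, so that N satisfies [A] with the
    satisfaction relation of finitely many formulae, which is arithmetical; a
    truth definition in [A] would contradict Tarski's theorem.  Derivability is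
    reduced to truth in all models by the completeness theorem. *)

(** * Substitution *)

Lemma tsubst_comp s1 s2 t :
  tsubst s2 (tsubst s1 t) = tsubst (fun n => tsubst s2 (s1 n)) t.
Proof. by elim: t => //= t1 -> t2 ->. Qed.

Lemma tsubst_id t : tsubst tVar t = t.
Proof. by elim: t => //= t1 -> t2 ->. Qed.

Lemma up_id : up tVar = tVar.
Proof. by apply: functional_extensionality; case. Qed.

Lemma up_comp s1 s2 :
  (fun n => tsubst (up s2) (up s1 n)) = up (fun n => tsubst s2 (s1 n)).
Proof.
apply: functional_extensionality; case=> //= n.
by rewrite /tshift !tsubst_comp.
Qed.

Lemma subst_id A : subst tVar A = A.
Proof.
elim: A => //= [t u|t u|i ts|A -> B ->|A IH] //; rewrite ?tsubst_id //.
- by rewrite (eq_map tsubst_id) map_id.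
- by rewrite up_id IH.
Qed.

Lemma subst_comp s1 s2 A :
  subst s2 (subst s1 A) = subst (fun n => tsubst s2 (s1 n)) A.
Proof.
elim: A s1 s2 => //= [t u|t u|i ts|A IHA B IHB|A IH] s1 s2.
- by rewrite !tsubst_comp.
- by rewrite !tsubst_comp.
- by rewrite -map_comp; congr fRel; apply: eq_map => t /=; rewrite tsubst_comp.
- by rewrite IHA IHB.
- by rewrite IH up_comp.
Qed.

Lemma tsubst_scons_shift u s t : tsubst (scons u s) (tshift t) = tsubst s t.
Proof. by rewrite /tshift tsubst_comp. Qed.

Lemma tsubst_inst_shift u t : tsubst (scons u tVar) (tshift t) = t.
Proof. by rewrite tsubst_scons_shift tsubst_id. Qed.

Lemma inst_up s A t : inst (subst (up s) A) t = subst (scons t s) A.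
Proof.
rewrite /inst subst_comp; congr subst; apply: functional_extensionality.
by case=> //= n; rewrite tsubst_inst_shift.
Qed.

Lemma subst_inst s A t : subst s (inst A t) = inst (subst (up s) A) (tsubst s t).
Proof.
rewrite inst_up /inst subst_comp; congr subst.
by apply: functional_extensionality; case.
Qed.

Lemma subst_up_shift s A : subst (up s) (shift A) = shift (subst s A).
Proof. by rewrite /shift !subst_comp. Qed.

(** The free variables of [A] are below [k], in extensional form. *)
Definition bounded_by (k : nat) (A : form) : Prop :=
  forall s1 s2, (forall n, n < k -> s1 n = s2 n) -> subst s1 A = subst s2 A.

Definition tbounded_by (k : nat) (t : term) : Prop :=
  forall s1 s2, (forall n, n < k -> s1 n = s2 n) -> tsubst s1 t = tsubst s2 t.

Lemma tbounded_ex t : exists k, tbounded_by k t.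
Proof.
elim: t => [n| | |t [k1 H1] u [k2 H2]|t [k1 H1] u [k2 H2]].
- by exists n.+1 => s1 s2 /= ->.
- by exists 0.
- by exists 0.
- exists (maxn k1 k2) => s1 s2 H /=; congr tAdd; [apply: H1|apply: H2] => n Hn;
    by apply: H; rewrite leq_max Hn ?orbT.
- exists (maxn k1 k2) => s1 s2 H /=; congr tMul; [apply: H1|apply: H2] => n Hn;
    by apply: H; rewrite leq_max Hn ?orbT.
Qed.

Lemma bounded_le k m A : k <= m -> bounded_by k A -> bounded_by m A.
Proof. by move=> km H s1 s2 E; apply: H => n /leq_trans nk; apply/E/nk. Qed.

Lemma bounded_ex A : exists k, bounded_by k A.
Proof.
elim: A => [|t u|t u|i ts|A [k1 H1] B [k2 H2]|A [k H]].
- by exists 0.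
- have [[k1 H1] [k2 H2]] := (tbounded_ex t, tbounded_ex u).
  exists (maxn k1 k2) => s1 s2 H /=; congr fEq; [apply: H1|apply: H2] => n Hn;
    by apply: H; rewrite leq_max Hn ?orbT.
- have [[k1 H1] [k2 H2]] := (tbounded_ex t, tbounded_ex u).
  exists (maxn k1 k2) => s1 s2 H /=; congr fLt; [apply: H1|apply: H2] => n Hn;
    by apply: H; rewrite leq_max Hn ?orbT.
- elim: ts => [|t ts [k1 H1]]; first by exists 0.
  have [k2 H2] := tbounded_ex t; exists (maxn k1 k2) => s1 s2 H /=.
  congr (fRel _ (_ :: _)).
  + by apply: H2 => n Hn; apply: H; rewrite leq_max Hn orbT.
  + have [] // : subst s1 (fRel i ts) = subst s2 (fRel i ts).
    by apply: H1 => n Hn; apply: H; rewrite leq_max Hn.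
- exists (maxn k1 k2) => s1 s2 H /=; congr fImp; [apply: H1|apply: H2] => n Hn;
    by apply: H; rewrite leq_max Hn ?orbT.
- exists k => s1 s2 E /=; congr fAll; apply: H; case=> //= n nk.
  by rewrite E // ltnW.
Qed.

Lemma bounded_seq_ex (G : seq form) :
  exists k, forall A, List.In A G -> bounded_by k A.
Proof.
elim: G => [|A G [k H]]; first by exists 0.
have [m Hm] := bounded_ex A; exists (maxn m k) => B /= [<-|/H HB].
- by apply: bounded_le Hm; rewrite leq_maxl.
- by apply: bounded_le HB; rewrite leq_maxr.
Qed.

(** * Derivations *)

Lemma In_map (T1 T2 : Type) (f : T1 -> T2) (x : T1) (s : seq T1) :
  List.In x s -> List.In (f x) (map f s).
Proof. by elim: s => //= y s IH [->|/IH]; [left|right]. Qed.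

Lemma In_map_inv (T1 T2 : Type) (f : T1 -> T2) (y : T2) (s : seq T1) :
  List.In y (map f s) -> exists2 x, List.In x s & y = f x.
Proof.
elim: s => //= x s IH [<-|/IH [z zs ->]]; first by exists x => //; left.
by exists z => //; right.
Qed.

Lemma eq_map_In (T1 T2 : Type) (f g : T1 -> T2) (s : seq T1) :
  (forall x, List.In x s -> f x = g x) -> map f s = map g s.
Proof.
elim: s => //= x s IH H; rewrite H; last by left.
by rewrite IH // => y ys; apply: H; right.
Qed.

Lemma derives_weaken G G' A :
  derives G A -> (forall B, List.In B G -> List.In B G') -> derives G' A.
Proof.
move=> D; elim: D G' => {G A}.
- by move=> G A H G' S; apply: D_hyp; apply: S.
- by move=> G A B _ IH G' S; apply: D_impI; apply: IH => C /= [<-|/S]; [left|right].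
- by move=> G A B _ IH1 _ IH2 G' S; apply: D_impE; [apply: IH1|apply: IH2].
- by move=> G A _ IH G' S; apply: D_raa; apply: IH => C /= [<-|/S]; [left|right].
- move=> G A _ IH G' S; apply: D_allI; apply: IH => C HC; have [D DG ->] := In_map_inv HC.
  by apply: In_map; apply: S.
- by move=> G A t _ IH G' S; apply: D_allE; apply: IH.
- by move=> G t G' _; apply: D_eqI.
- by move=> G A s t _ IH1 _ IH2 G' S; apply: (@D_eqE _ A s); [apply: IH1|apply: IH2].
Qed.

Lemma derives_subst G A s :
  derives G A -> derives (map (subst s) G) (subst s A).
Proof.
move=> D; elim: D s => {G A}.
- by move=> G A H s; apply: D_hyp; apply: In_map.
- by move=> G A B _ IH s; apply: D_impI; apply: (IH s).
- by move=> G A B _ IH1 _ IH2 s; apply: D_impE (IH2 s); apply: IH1.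
- by move=> G A _ IH s; apply: D_raa; apply: (IH s).
- move=> G A _ IH s /=; apply: D_allI; have := IH (up s).
  rewrite -!map_comp; congr (derives _ _); apply: eq_map => B /=.
  by rewrite subst_up_shift.
- by move=> G A t _ IH s; rewrite subst_inst; apply: D_allE; apply: (IH s).
- by move=> G t s; apply: D_eqI.
- move=> G A t u _ IH1 _ IH2 s; rewrite subst_inst.
  by apply: (@D_eqE _ _ (tsubst s t)); [apply: IH1|rewrite -subst_inst].
Qed.

Lemma derives_absurd G A B : derives G A -> derives G (fNot A) -> derives G B.
Proof.
move=> DA DN; apply: D_raa; apply: (@D_impE _ A).
- by apply: derives_weaken DN _ => C; right.
- by apply: derives_weaken DA _ => C; right.
Qed.

Lemma derives_cut G A B : derives G A -> derives (A :: G) B -> derives G B.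
Proof. by move=> DA DB; apply: D_impE DA; apply: D_impI. Qed.

(* The substitution sends the fresh variable [x] to 0 and shifts the others. *)
Lemma derives_gen G A x :
  (forall B, List.In B G -> bounded_by x B) -> bounded_by x (fAll A) ->
  derives G (inst A (tVar x)) -> derives G (fAll A).
Proof.
move=> HG HA D; apply: D_allI.
pose s n := if n == x then tVar 0 else tVar n.+1.
have sE n : n < x -> s n = tVar n.+1 by rewrite /s => /ltn_eqF ->.
have := derives_subst s D; congr derives.
- by apply: eq_map_In => B /HG HB; apply: HB.
- have [E] : subst s (fAll A) = subst (fun n => tVar n.+1) (fAll A) by apply: HA.
  rewrite subst_inst E inst_up /= /s eqxx.
  rewrite -{2}(subst_id A); congr subst; apply: functional_extensionality.
  by case.
Qed.

(** * Semantics *)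

Lemma eval_tsubst M (v : nat -> dom M) s t :
  eval v (tsubst s t) = eval (fun n => eval v (s n)) t.
Proof. by elim: t => //= t1 -> t2 ->. Qed.

Lemma eval_tshift M (v : nat -> dom M) d t :
  eval (scons d v) (tshift t) = eval v t.
Proof. by rewrite eval_tsubst. Qed.

Lemma sat_subst M (v : nat -> dom M) s A :
  sat v (subst s A) <-> sat (fun n => eval v (s n)) A.
Proof.
elim: A v s => //= [t u|t u|i ts|A IHA B IHB|A IH] v s.
- by rewrite !eval_tsubst.
- by rewrite !eval_tsubst.
- rewrite -map_comp; set l1 := map _ _; set l2 := map _ _.
  suff -> : l1 = l2 by []. by apply: eq_map => t /=; rewrite eval_tsubst.
- by rewrite IHA IHB.
- have E d : (fun n => eval (scons d v) (up s n)) = scons d (fun n => eval v (s n)).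
    by apply: functional_extensionality; case=> //= n; rewrite eval_tshift.
  by split=> H d; have := H d; rewrite IH E.
Qed.

Lemma sat_inst M (v : nat -> dom M) A t :
  sat v (inst A t) <-> sat (scons (eval v t) v) A.
Proof.
rewrite sat_subst; set w := (fun n => _).
suff -> : w = scons (eval v t) v by [].
by apply: functional_extensionality; case.
Qed.

Lemma sat_not M (v : nat -> dom M) A : sat v (fNot A) <-> ~ sat v A.
Proof. by []. Qed.

Lemma sat_all M (v : nat -> dom M) A :
  sat v (fAll A) <-> forall d, sat (scons d v) A.
Proof. by []. Qed.

Lemma sat_and M (v : nat -> dom M) A B :
  sat v (fAnd A B) <-> sat v A /\ sat v B.
Proof.
split=> /= [H|[HA HB] H]; last by apply: H.
by split; apply: NNPP => N; apply: H => HA // HB.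
Qed.

Lemma sat_or M (v : nat -> dom M) A B :
  sat v (fOr A B) <-> sat v A \/ sat v B.
Proof.
split=> /= [H|[HA|HB]] //.
by case: (classic (sat v A)) => HA; [left|right; apply: H].
Qed.

Lemma sat_iff M (v : nat -> dom M) A B :
  sat v (fIff A B) <-> (sat v A <-> sat v B).
Proof. by rewrite sat_and. Qed.

Lemma sat_ex M (v : nat -> dom M) A :
  sat v (fEx A) <-> exists d, sat (scons d v) A.
Proof.
split=> [H|[d Hd] H]; last exact: H Hd.
by apply: NNPP => N; apply: H => d Hd; apply: N; exists d.
Qed.

Lemma sat_le M (v : nat -> dom M) t u :
  sat v (fLe t u) <-> i_lt (eval v t) (eval v u) \/ eval v t = eval v u.
Proof. exact: sat_or. Qed.

Lemma sat_ball M (v : nat -> dom M) t A :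
  sat v (fBAll t A) <-> forall d, i_lt d (eval v t) -> sat (scons d v) A.
Proof. by split=> H d; have := H d; rewrite /= eval_tshift. Qed.

Lemma soundness G A : derives G A ->
  forall M (v : nat -> dom M), (forall B, List.In B G -> sat v B) -> sat v A.
Proof.
elim=> {G A}.
- by move=> G A H M v; apply.
- by move=> G A B _ IH M v H HA; apply: IH => C /= [<-|/H].
- by move=> G A B _ IH1 _ IH2 M v H; apply: (IH1 M v H); apply: IH2.
- by move=> G A _ IH M v H; apply: NNPP => N; apply: (IH M v) => C /= [<-|/H].
- move=> G A _ IH M v H d; apply: IH => C HC; have [B BG ->] := In_map_inv HC.
  by rewrite /shift sat_subst; apply: H.
- by move=> G A t _ IH M v H; rewrite sat_inst; apply: (IH M v H).
- by [].
- by move=> G A s t _ IH1 _ IH2 M v H; rewrite sat_inst -(IH1 M v H) -sat_inst; apply: IH2.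
Qed.

(** * Injectivity of the coding *)

(** The sum [x + y] is the integer square root of [npair x y], because [x < 2 * (x + y) + 1]; it is
    recovered first, and [x] is what remains. *)
Lemma npair_inj x y x' y' : npair x y = npair x' y' -> x = x' /\ y = y'.
Proof.
rewrite /npair => E.
have aux a b a' b' : (a + b) ^ 2 + a = (a' + b') ^ 2 + a' -> a + b <= a' + b'.
  move=> E1; rewrite leqNgt; apply/negP => lt.
  have : (a' + b').+1 ^ 2 <= (a + b) ^ 2 by rewrite leq_exp2r.
  rewrite leqNgt => /negP; apply.
  apply: (@leq_ltn_trans ((a + b) ^ 2 + a)); first exact: leq_addr.
  by rewrite E1 -!mulnn; nia.
have S : x + y = x' + y' by apply/eqP; rewrite eqn_leq !aux.
by move: E; rewrite S => /addnI Ex; split=> //; move: S; rewrite Ex => /addnI.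
Qed.

Lemma code_term_inj : injective code_term.
Proof.
elim=> [n| | |t IHt u IHu|t IHt u IHu] [m| | |t' u'|t' u'] /= /npair_inj [] //.
- by move=> _ ->.
- by move=> _ /npair_inj [/IHt -> /IHu ->].
- by move=> _ /npair_inj [/IHt -> /IHu ->].
Qed.

Lemma code_terms_inj : injective code_terms.
Proof.
by elim=> [|t ts IH] [|u us] //= [] /npair_inj [/code_term_inj -> /IH ->].
Qed.

Lemma code_inj : injective code.
Proof.
elim=> [|t u|t u|i ts|A IHA B IHB|A IHA] [|t' u'|t' u'|j us|A' B'|A'] /=
  /npair_inj [] // _.
- by move=> /npair_inj [/code_term_inj -> /code_term_inj ->].
- by move=> /npair_inj [/code_term_inj -> /code_term_inj ->].
- by move=> /npair_inj [-> /code_terms_inj ->].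
- by move=> /npair_inj [/IHA -> /IHB ->].
- by move=> /IHA ->.
Qed.

(** * Completeness *)

(** A left inverse of [code] taken by choice. Its values off the range of [code] are unspecified,
    which is harmless: every formula is still enumerated. *)
Definition enum_form (n : nat) : form :=
  epsilon (inhabits fBot) (fun A => code A = n).

Lemma enum_formK A : enum_form (code A) = A.
Proof. by apply: code_inj; apply: (@epsilon_spec _ _ (fun B => code B = code A)); exists A. Qed.

Definition con (G : seq form) : Prop := ~ derives G fBot.

Definition decided (G : seq form) (F : form) : Prop :=
  List.In F G \/ (List.In (fNot F) G /\
    forall B, F = fAll B -> exists x, List.In (fNot (inst B (tVar x))) G).

(* Variables play the role of Henkin constants. *)
Lemma henkin_step G F : con G -> exists G',
  [/\ con G', forall B, List.In B G -> List.In B G' & decided G' F].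
Proof.
move=> cG; case: (classic (con (F :: G))) => [cF|/NNPP dF].
  by exists (F :: G); split=> // [B ?|]; [right|left; left].
have dN : derives G (fNot F) by apply: D_impI.
have cN : con (fNot F :: G) by move=> D; apply: cG; apply: derives_cut D.
case: (classic (exists B, F = fAll B)) => [[B EF]|NF]; last first.
  exists (fNot F :: G); split=> // [B ?|]; first by right.
  by right; split=> [|B E]; [left|case: NF; exists B].
(* The list is finite, so some variable lies beyond all its free variables. If adding the negated
   instance at [x] were inconsistent, generalisation would derive [F] from [fNot F :: G]. *)
have [x Hx] := bounded_seq_ex (F :: fNot F :: G).
exists (fNot (inst B (tVar x)) :: fNot F :: G); split.
- move=> D; apply: cN; apply: (@derives_absurd _ F); last by apply: D_hyp; left.
  rewrite {2}EF; apply: (@derives_gen _ _ x).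
  + by move=> C HC; apply: Hx; right.
  + by rewrite -EF; apply: Hx; left.
  + exact: D_raa.
- by move=> C ?; right; right.
- right; split=> [|C]; first by right; left.
  by rewrite EF => -[<-]; exists x; left.
Qed.

Section Henkin.
Variables (G0 : seq form) (cG0 : con G0).

Fixpoint chain (n : nat) : {G | con G} :=
  if n is m.+1 then
    let: exist G cG := chain m in
    let: exist G' H := constructive_indefinite_description _ (henkin_step (enum_form m) cG) in
    exist _ G' (let: And3 c _ _ := H in c)
  else exist _ G0 cG0.

Lemma chainS n :
  (forall B, List.In B (sval (chain n)) -> List.In B (sval (chain n.+1))) /\
  decided (sval (chain n.+1)) (enum_form n).
Proof.
rewrite /=; case: (chain n) => G cG /=.
by case: constructive_indefinite_description => G' [] /=.
Qed.

Lemma chain_le n m B : n <= m -> List.In B (sval (chain n)) -> List.In B (sval (chain m)).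
Proof.
elim: m => [|m IH]; first by rewrite leqn0 => /eqP ->.
rewrite leq_eqVlt => /orP [/eqP -> //|lt H].
by apply: (proj1 (chainS m)); apply: IH.
Qed.

(** The union of the chain is a maximal consistent theory with witnesses, since stage [n.+1] decides
    [enum_form n]. *)
Definition henkin (F : form) : Prop := exists n, List.In F (sval (chain n)).

Lemma henkin_decided F : henkin F \/
  (henkin (fNot F) /\ forall B, F = fAll B -> exists x, henkin (fNot (inst B (tVar x)))).
Proof.
have := proj2 (chainS (code F)); rewrite enum_formK; case=> [H|[H1 H2]].
  by left; exists (code F).+1.
right; split; first by exists (code F).+1.
by move=> B /H2 [x Hx]; exists x; exists (code F).+1.
Qed.

Lemma henkin_con F : henkin F -> henkin (fNot F) -> False.
Proof.
move=> [n Hn] [m Hm]; case: (svalP (chain (maxn n m))).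
apply: (@D_impE _ F); apply: D_hyp.
- by apply: chain_le Hm; apply: leq_maxr.
- by apply: chain_le Hn; apply: leq_maxl.
Qed.

Lemma henkin_finite (L : seq form) : (forall B, List.In B L -> henkin B) ->
  exists n, forall B, List.In B L -> List.In B (sval (chain n)).
Proof.
elim: L => [|A L IH] H; first by exists 0.
have [n Hn] : henkin A by apply: H; left.
have [|m Hm] := IH; first by move=> B HB; apply: H; right.
exists (maxn n m) => B /= [<-|/Hm HB].
- by apply: chain_le Hn; apply: leq_maxl.
- by apply: chain_le HB; apply: leq_maxr.
Qed.

(** Finitely many premises lie in a single stage; if [F] were not in the union, [fNot F] would be,
    and some later stage would be inconsistent. *)
Lemma henkin_derives L F : derives L F -> (forall B, List.In B L -> henkin B) -> henkin F.
Proof.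
move=> D /henkin_finite [n Hn].
case: (henkin_decided F) => // -[[m Hm] _].
case: (svalP (chain (maxn n m))); apply: (@D_impE _ F).
- by apply: D_hyp; apply: chain_le Hm; apply: leq_maxr.
- apply: derives_weaken D _ => B /Hn HB.
  by apply: chain_le HB; apply: leq_maxl.
Qed.

Lemma henkin_imp F1 F2 : henkin (fImp F1 F2) <-> (henkin F1 -> henkin F2).
Proof.
split=> [H H1|H].
  apply: (@henkin_derives [:: fImp F1 F2; F1]) => [|B /= [<-|[<-|[]]]] //.
  by apply: (@D_impE _ F1); apply: D_hyp; [left|right; left].
case: (henkin_decided F1) => [/H H2|[H1 _]].
  apply: (@henkin_derives [:: F2]) => [|B /= [<-|[]]] //.
  by apply: D_impI; apply: D_hyp; right; left.
apply: (@henkin_derives [:: fNot F1]) => [|B /= [<-|[]]] //.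
apply: D_impI; apply: (@derives_absurd _ F1); apply: D_hyp; first by left.
by right; left.
Qed.

Lemma henkin_bot : ~ henkin fBot.
Proof. by move=> [n H]; case: (svalP (chain n)); apply: D_hyp. Qed.

Lemma henkin_all B : henkin (fAll B) <-> (forall t, henkin (inst B t)).
Proof.
split=> [H t|H].
  apply: (@henkin_derives [:: fAll B]) => [|C /= [<-|[]]] //.
  by apply: D_allE; apply: D_hyp; left.
case: (henkin_decided (fAll B)) => // -[_ /(_ B erefl) [x Hx]].
by case: (henkin_con (H (tVar x)) Hx).
Qed.

Lemma henkin_rewrite A s t : henkin (fEq s t) -> henkin (inst A s) -> henkin (inst A t).
Proof.
move=> E H; apply: (@henkin_derives [:: fEq s t; inst A s]) => [|B /= [<-|[<-|[]]]] //.
by apply: (@D_eqE _ A s); apply: D_hyp; [left|right; left].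
Qed.

Lemma henkin_refl t : henkin (fEq t t).
Proof. by apply: (@henkin_derives [::]) => //; apply: D_eqI. Qed.

Lemma henkin_sym s t : henkin (fEq s t) -> henkin (fEq t s).
Proof.
move=> H; have := @henkin_rewrite (fEq (tVar 0) (tshift s)) s t H.
by rewrite /inst /= !tsubst_inst_shift; apply; apply: henkin_refl.
Qed.

Lemma henkin_trans t s u : henkin (fEq s t) -> henkin (fEq t u) -> henkin (fEq s u).
Proof.
move=> H1 H2; have := @henkin_rewrite (fEq (tshift s) (tVar 0)) t u H2.
by rewrite /inst /= !tsubst_inst_shift; apply.
Qed.

(** Equality elimination replaces one argument at a time: variable 0 marks the place, and the other
    terms are shifted so as to stay untouched. *)
Lemma henkin_cong2 (op : term -> term -> term) s s' t t' :
  (forall r a b, tsubst r (op a b) = op (tsubst r a) (tsubst r b)) ->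
  henkin (fEq s s') -> henkin (fEq t t') -> henkin (fEq (op s t) (op s' t')).
Proof.
move=> opE Hs Ht; apply: (@henkin_trans (op s' t)).
- have := @henkin_rewrite (fEq (tshift (op s t)) (op (tVar 0) (tshift t))) s s' Hs.
  rewrite /inst /= !opE !tsubst_inst_shift /=; apply; exact: henkin_refl.
- have := @henkin_rewrite (fEq (tshift (op s' t)) (op (tshift s') (tVar 0))) t t' Ht.
  rewrite /inst /= !opE !tsubst_inst_shift /=; apply; exact: henkin_refl.
Qed.

Lemma henkin_lt s s' t t' :
  henkin (fEq s s') -> henkin (fEq t t') -> henkin (fLt s t) -> henkin (fLt s' t').
Proof.
move=> Hs Ht H.
have := @henkin_rewrite (fLt (tVar 0) (tshift t)) s s' Hs.
rewrite /inst /= !tsubst_inst_shift => /(_ H) H'.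
have := @henkin_rewrite (fLt (tshift s') (tVar 0)) t t' Ht.
by rewrite /inst /= !tsubst_inst_shift => /(_ H').
Qed.

(** The prefix [pre] collects the arguments already treated, so that the induction replaces them
    from left to right. *)
Lemma henkin_rel i f (ts pre : seq term) : (forall t, henkin (fEq t (f t))) ->
  henkin (fRel i (pre ++ ts)) <-> henkin (fRel i (pre ++ map f ts)).
Proof.
move=> Hf.
have sub u p : map (tsubst (scons u tVar)) (map tshift p) = p.
  by rewrite -map_comp -[RHS]map_id; apply: eq_map => t /=; rewrite tsubst_inst_shift.
have one a b p q : henkin (fEq a b) -> henkin (fRel i (p ++ a :: q)) -> henkin (fRel i (p ++ b :: q)).
  move=> E H; have := @henkin_rewrite (fRel i (map tshift p ++ tVar 0 :: map tshift q)) a b E.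
  by rewrite /inst /= !map_cat /= !sub; apply.
elim: ts pre => [|t ts IH] pre //=.
rewrite -cat_rcons -(cat_rcons (f t)) -IH !cat_rcons.
by split; apply: one; [|apply: henkin_sym].
Qed.

(** * The term model, built on representatives of provable equality *)

Definition rep (t : term) : term := epsilon (inhabits t) (fun u => henkin (fEq t u)).

Lemma repP t : henkin (fEq t (rep t)).
Proof. by apply: (epsilon_spec (inhabits t) (fun u => henkin (fEq t u))); exists t; apply: henkin_refl. Qed.

(** Provably equal terms have the same set of equals, so choice picks the same element for both; the
    two proofs of inhabitation are identified by proof irrelevance. *)
Lemma rep_eq s t : henkin (fEq s t) -> rep s = rep t.
Proof.
move=> H.
have E : (fun u => henkin (fEq s u)) = (fun u => henkin (fEq t u)).
  apply: functional_extensionality => u; apply: propositional_extensionality.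
  by split; apply: henkin_trans; [apply: henkin_sym|].
rewrite /rep E; congr epsilon; exact: proof_irrelevance.
Qed.

Lemma rep_rep t : rep (rep t) = rep t.
Proof. by apply/rep_eq/henkin_sym/repP. Qed.

(** Chosen representatives stand for equivalence classes, so that [fEq] can be interpreted by
    genuine equality, as [sat] demands. *)
Definition tclass : Type := {t | rep t = t}.
Definition cls (t : term) : tclass := exist _ (rep t) (rep_rep t).

Lemma cls_sval (a : tclass) : cls (sval a) = a.
Proof. by case: a => t e; apply: eq_exist_uncurried; exists e; apply: proof_irrelevance. Qed.

Lemma cls_eq s t : cls s = cls t <-> henkin (fEq s t).
Proof.
split=> [[E]|/rep_eq E].
  by apply: (henkin_trans (repP s)); rewrite E; apply: henkin_sym; apply: repP.
by apply: eq_exist_uncurried; exists E; apply: proof_irrelevance.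
Qed.

Definition term_model : structure :=
  @Structure tclass (cls tZero) (cls tOne)
    (fun a b => cls (tAdd (sval a) (sval b)))
    (fun a b => cls (tMul (sval a) (sval b)))
    (fun a b => henkin (fLt (sval a) (sval b)))
    (fun i ds => henkin (fRel i (map sval ds))).

Lemma eval_cls s t : @eval term_model (fun n => cls (s n)) t = cls (tsubst s t).
Proof.
elim: t => //= t1 -> t2 -> /=; apply/cls_eq; apply: henkin_cong2 => //;
  apply: henkin_sym; apply: repP.
Qed.

Lemma scons_cls t s : scons (cls t) (fun n => cls (s n)) = (fun n => cls (scons t s n)).
Proof. by apply: functional_extensionality; case. Qed.

(** Every element of the term model is the class of a term, so a quantifier over the model amounts
    to all instances, as in [henkin_all]. *)
Lemma truth s F : @sat term_model (fun n => cls (s n)) F <-> henkin (subst s F).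
Proof.
elim: F s => [|t u|t u|i ts|A IHA B IHB|A IH] s.
- by split=> // /henkin_bot.
- by rewrite /= !eval_cls cls_eq.
- rewrite /= !eval_cls /=; split; apply: henkin_lt; try exact: repP;
    apply: henkin_sym; apply: repP.
- rewrite /= -map_comp.
  have -> : map (fun t => sval (@eval term_model (fun n => cls (s n)) t)) ts =
            map rep (map (tsubst s) ts).
    by rewrite -map_comp; apply: eq_map => t /=; rewrite eval_cls.
  by rewrite -(@henkin_rel i rep (map (tsubst s) ts) [::]) //; apply: repP.
- by rewrite /= henkin_imp IHA IHB.
- rewrite /= henkin_all; split=> [H t|H d].
    by rewrite inst_up -IH -scons_cls.
  by rewrite -(cls_sval d) scons_cls IH -inst_up.
Qed.

End Henkin.

(** If [C] were not derivable, [A] would be consistent with [fNot C], and their term model, with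
    each variable sent to its own class, would refute the hypothesis. *)
Theorem completeness A C :
  (forall M (v : nat -> dom M), sat v A -> sat v C) -> derives [:: A] C.
Proof.
move=> H; apply: NNPP => N.
have cG : con [:: fNot C; A] by move=> D; apply/N/D_raa.
pose v := fun n => cls cG (tVar n).
have Hv F : List.In F [:: fNot C; A] -> @sat (term_model cG) v F.
  by move=> HF; apply/truth; rewrite subst_id; exists 0.
apply: (Hv (fNot C)); first by left.
by apply: H; apply: Hv; right; left.
Qed.

(** * Free variables *)

Lemma eval_below k t M (v w : nat -> dom M) : term_below k t ->
  (forall n, n < k -> v n = w n) -> eval v t = eval w t.
Proof.
move=> Ht E; elim: t Ht => //= [t IHt u IHu|t IHt u IHu] /andP [Ht Hu];
  by rewrite IHt ?IHu.
Qed.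

Lemma sat_below L k A M (v w : nat -> dom M) : formula_of L k A ->
  (forall n, n < k -> v n = w n) -> sat v A <-> sat w A.
Proof.
elim: A k v w => //= [t u|t u|i ts|A IHA B IHB|A IH] k v w.
- by move=> /andP [Ht Hu] E; rewrite (eval_below Ht E) (eval_below Hu E).
- by move=> /andP [Ht Hu] E; rewrite (eval_below Ht E) (eval_below Hu E).
- move=> /andP [_ Hts] E; suff -> : map (eval v) ts = map (eval w) ts by [].
  elim: ts Hts => //= t ts IH /andP [Ht Hts].
  by rewrite IH // (eval_below Ht E).
- by move=> /andP [HA HB] E; rewrite (IHA _ _ _ HA E) (IHB _ _ _ HB E).
- move=> HA E; split=> H d; have := H d; rewrite (IH _ _ (scons d w) HA) //;
    by case=> //= n /E.
Qed.

Lemma sat_sentence L A M (v w : nat -> dom M) : sentence_of L A -> sat v A <-> sat w A.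
Proof. by move=> HA; apply: (sat_below HA). Qed.

Lemma term_below_subst k m s t : term_below k t ->
  (forall n, n < k -> term_below m (s n)) -> term_below m (tsubst s t).
Proof.
move=> Ht Hs; elim: t Ht => //= [t IHt u IHu|t IHt u IHu] /andP [Ht Hu];
  by rewrite IHt ?IHu.
Qed.

Lemma term_below_shift k t : term_below k t -> term_below k.+1 (tshift t).
Proof. by move=> Ht; apply: term_below_subst Ht _. Qed.

Lemma formula_of_subst L k m s A : formula_of L k A ->
  (forall n, n < k -> term_below m (s n)) -> formula_of L m (subst s A).
Proof.
elim: A k m s => //= [t u|t u|i ts|A IHA B IHB|A IH] k m s.
- by move=> /andP [Ht Hu] Hs; rewrite (term_below_subst Ht Hs) (term_below_subst Hu Hs).
- by move=> /andP [Ht Hu] Hs; rewrite (term_below_subst Ht Hs) (term_below_subst Hu Hs).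
- move=> /andP [iL Hts] Hs; rewrite size_map iL /= all_map.
  by apply: sub_all Hts => t Ht /=; apply: term_below_subst Ht Hs.
- by move=> /andP [HA HB] Hs; rewrite (IHA k) ?(IHB k).
- move=> HA Hs; apply: IH HA _ => -[|n] //= nk.
  exact/term_below_shift/Hs.
Qed.

Lemma term_below_le k m t : k <= m -> term_below k t -> term_below m t.
Proof.
move=> km; elim: t => //= [n nk|t IHt u IHu /andP [/IHt -> /IHu ->]
  |t IHt u IHu /andP [/IHt -> /IHu ->]] //; exact: leq_trans km.
Qed.

Lemma formula_of_le (L L' : language) k m A : {subset L <= L'} -> k <= m ->
  formula_of L k A -> formula_of L' m A.
Proof.
move=> LL'; elim: A k m => //= [t u|t u|i ts|A IHA B IHB|A IH] k m km.
- by move=> /andP [Ht Hu]; rewrite (term_below_le km Ht) (term_below_le km Hu).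
- by move=> /andP [Ht Hu]; rewrite (term_below_le km Ht) (term_below_le km Hu).
- move=> /andP [/LL' -> Hts] /=; apply: sub_all Hts => t; exact: term_below_le.
- by move=> /andP [HA HB]; rewrite (IHA k) ?(IHB k).
- exact: IH.
Qed.

Lemma formula_of_fAlls L k m A : formula_of L k (fAlls m A) = formula_of L (m + k) A.
Proof. by elim: m k => //= m IH k; rewrite IH addnS. Qed.

Lemma sat_fAlls M k A (v : nat -> dom M) :
  (forall w : nat -> dom M, sat w A) -> sat v (fAlls k A).
Proof. by move=> H; elim: k v => //= k IH v d; apply: IH. Qed.

Lemma term_below_numeral k n : term_below k (numeral n).
Proof. by elim: n => //= n ->. Qed.

(** * Models of PA^- *)

Fixpoint num (M : structure) (n : nat) : dom M :=
  if n is m.+1 then i_add (num M m) (i_one M) else i_zero M.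

Lemma eval_numeral M (v : nat -> dom M) n : eval v (numeral n) = num M n.
Proof. by elim: n => //= n ->. Qed.

Lemma num_std n : num std_model n = n.
Proof. by elim: n => //= n ->; rewrite addn1. Qed.

Definition PAminus_model (M : structure) : Prop :=
  forall A (v : nat -> dom M), List.In A PAminus -> sat v A.

Lemma PAminus_sentence A : List.In A PAminus -> sentence_of L_A A.
Proof. by do 17?[case=> [<- //|]]. Qed.

Section PAminusModel.
Variables (M : structure) (HM : PAminus_model M).
Notation "x [+] y" := (@i_add M x y) (at level 50, left associativity).
Notation "x [*] y" := (@i_mul M x y) (at level 40, left associativity).
Notation "x [<] y" := (@i_lt M x y) (at level 70).
Notation zero := (i_zero M).
Notation one := (i_one M).

(** Axioms are used through their position in the list. The outermost quantifier binds the largest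
    index, so arguments are passed in reverse order. *)
Lemma PAminus_nth i : i < size PAminus -> sat (fun=> zero) (nth fBot PAminus i).
Proof.
move=> Hi; apply: HM; elim: PAminus i Hi => //= A s IH [_|i /IH]; by [left|right].
Qed.

Let ax i (Hi : i < size PAminus) := PAminus_nth Hi.

Lemma M_addA x y z : x [+] y [+] z = x [+] (y [+] z).
Proof. exact: (@ax 0 isT z y x). Qed.
Lemma M_addC x y : x [+] y = y [+] x.
Proof. exact: (@ax 1 isT y x). Qed.
Lemma M_mulDr x y z : x [*] (y [+] z) = x [*] y [+] x [*] z.
Proof. exact: (@ax 4 isT z y x). Qed.
Lemma M_add0 x : x [+] zero = x.
Proof. exact: (@ax 5 isT x). Qed.
Lemma M_mul0 x : x [*] zero = zero.
Proof. exact: (@ax 6 isT x). Qed.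
Lemma M_mul1 x : x [*] one = x.
Proof. exact: (@ax 7 isT x). Qed.
Lemma M_lt_trans x y z : x [<] y -> y [<] z -> x [<] z.
Proof. exact: (@ax 8 isT z y x). Qed.
Lemma M_lt_irr x : ~ x [<] x.
Proof. exact: (@ax 9 isT x). Qed.
Lemma M_lt_tri x y : [\/ x [<] y, x = y | y [<] x].
Proof.
have := @ax 10 isT y x : sat (scons x (scons y (fun=> zero)))
  (fOr (fLt (tVar 0) (tVar 1)) (fOr (fEq (tVar 0) (tVar 1)) (fLt (tVar 1) (tVar 0)))).
by rewrite !sat_or => -[H|[H|H]]; [constructor 1|constructor 2|constructor 3].
Qed.
Lemma M_lt_add x y z : x [<] y -> x [+] z [<] y [+] z.
Proof. exact: (@ax 11 isT z y x). Qed.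
Lemma M_lt_diff x y : x [<] y -> exists z, x [+] z = y.
Proof.
move=> H; have := @ax 13 isT y x H : sat (scons x (scons y (fun=> zero)))
  (fEx (fEq (tAdd (tVar 1) (tVar 0)) (tVar 2))).
by rewrite sat_ex.
Qed.
Lemma M_lt01 : zero [<] one.
Proof. exact: (@ax 14 isT). Qed.
Lemma M_discrete x : zero [<] x -> one [<] x \/ one = x.
Proof.
move=> H; have := @ax 15 isT x H : sat (scons x (fun=> zero)) (fLe tOne (tVar 0)).
by rewrite sat_le.
Qed.
Lemma M_ge0 x : zero [<] x \/ zero = x.
Proof.
have := @ax 16 isT x : sat (scons x (fun=> zero)) (fLe tZero (tVar 0)).
by rewrite sat_le.
Qed.

Lemma M_lt_succ x : x [<] x [+] one.
Proof. by have := M_lt_add x M_lt01; rewrite M_addC M_add0 (M_addC one). Qed.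

Lemma num_add a b : num M (a + b) = num M a [+] num M b.
Proof. by elim: b => [|b IH]; rewrite ?addn0 ?M_add0 // addnS /= IH M_addA. Qed.

Lemma num_mul a b : num M (a * b) = num M a [*] num M b.
Proof.
elim: b => [|b IH]; first by rewrite muln0 M_mul0.
by rewrite mulnS addnC num_add IH /= M_mulDr M_mul1.
Qed.

Lemma num_lt a b : a < b -> num M a [<] num M b.
Proof.
elim: b => // b IH; rewrite ltnS leq_eqVlt => /orP [/eqP ->|/IH H].
  exact: M_lt_succ.
exact: M_lt_trans H (M_lt_succ _).
Qed.

Lemma num_inj : injective (num M).
Proof.
move=> a b E; case: (ltngtP a b) => // /num_lt; rewrite E => /M_lt_irr [].
Qed.

Lemma num_ltE a b : num M a [<] num M b <-> a < b.
Proof.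
split=> [H|]; last exact: num_lt.
case: (ltngtP a b) => // [/num_lt H'|E].
  by case: (M_lt_irr (M_lt_trans H H')).
by move: H; rewrite E => /M_lt_irr.
Qed.

(** The numerals form an initial segment: by discreteness nothing lies strictly between [num M k]
    and its successor. *)
Lemma lt_num_inv x k : x [<] num M k -> exists2 j, j < k & x = num M j.
Proof.
elim: k => [|k IH] Hx.
  case: (M_ge0 x) => [H|E]; first by case: (M_lt_irr (M_lt_trans H Hx)).
  by move: Hx; rewrite -E => /M_lt_irr.
case: (M_lt_tri x (num M k)) => [/IH [j jk ->]|->|].
- by exists j => //; apply: ltnW.
- by exists k.
- move=> /M_lt_diff [d Ed]; case: (M_ge0 d) => [/M_discrete [H|H]|H].
  + have := M_lt_add (num M k) H; rewrite (M_addC d) Ed (M_addC one) => H'.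
    by case: (M_lt_irr (M_lt_trans Hx H')).
  + by move: Hx; rewrite -Ed -H => /M_lt_irr.
  + by exists k => //; rewrite -Ed -H M_add0.
Qed.

(** * Absoluteness between the standard model and models of PA^- *)

Lemma eval_num v t : eval (fun n => num M (v n)) t = num M (@eval std_model v t).
Proof. by elim: t => //= [|t -> u ->|t -> u ->]; rewrite ?num_add ?num_mul // M_addC M_add0. Qed.

Lemma scons_num a v : scons (num M a) (fun n => num M (v n)) = (fun n => num M (scons a v n)).
Proof. by apply: functional_extensionality; case. Qed.

(** Below a standard bound [M] has only numerals, so bounded quantifiers range over the same
    elements in [M] as in the standard model. *)
Lemma Delta0_absolute A : Delta0 A -> forall k v, formula_of L_A k A ->
  sat (fun n => num M (v n)) A <-> @sat std_model v A.
Proof.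
elim=> {A} [|t u|t u|i ts|A B _ IHA _ IHB|t A _ IH] k v //=.
- by move=> _; rewrite !eval_num; split=> [/num_inj|->].
- by move=> _; rewrite !eval_num num_ltE.
- by move=> /andP [HA HB]; rewrite (IHA k) // (IHB k).
- move=> /andP [_ HA]; split=> H d; rewrite eval_tshift.
    move=> Hd; have := H (num M d); rewrite eval_tshift eval_num scons_num.
    by move=> /(_ (num_lt Hd)); rewrite (IH k.+1).
  rewrite eval_num => /lt_num_inv [j Hj ->]; rewrite scons_num (IH k.+1) //.
  by apply: H; rewrite eval_tshift.
Qed.

Lemma Pi1_down A : Pi 1 A -> forall k v, formula_of L_A k A ->
  sat (fun n => num M (v n)) A -> @sat std_model v A.
Proof.
move En : 1 => n H; elim: H En => {n A} [//|n A HA|n A _ IH] En k v HkA H.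
- move: En HA => [<-]; move E0 : 0 => z HA.
  case: HA E0 H HkA => {z A} [A DA _|//|//] H HkA.
  by rewrite -(@Delta0_absolute A DA k v HkA).
- move=> d; apply: (IH En k.+1) HkA _; rewrite -scons_num; exact: H.
Qed.

End PAminusModel.

(* Variable 0 of [g] is the bound on the outer existential quantifiers of [sigma];
   the variables of [sigma] are shifted by one. *)
Lemma Sigma2_approximants sigma : Sigma 2 sigma ->
  forall k, formula_of L_A k sigma -> exists g,
  [/\ formula_of L_A k.+1 g,
      forall v c c', c <= c' -> @sat std_model (scons c' v) g -> @sat std_model (scons c v) g,
      forall v, (forall c, @sat std_model (scons c v) g) <-> ~ @sat std_model v sigma
    & forall M, PAminus_model M -> forall v, @sat std_model v g -> sat (fun n => num M (v n)) g].
Proof.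
move En : 2 => n H; elim: H En => {n sigma} [//|n A HA|n A _ IH] En k HkA.
(* Here [sigma] is Pi_1, with no outer existential quantifier to bound: the approximant ignores [c],
   and as a negated Pi_1 formula it passes upwards by [Pi1_down]. *)
- move: En HA => [<-] HA; exists (fNot (shift A)).
  have Fg : formula_of L_A k.+1 (shift A) by apply: formula_of_subst HkA _.
  have S M (v : nat -> dom M) c : sat (scons c v) (shift A) <-> sat v A.
    by rewrite /shift sat_subst.
  split=> [|v c c' _|v|M HM v].
  + by rewrite /= Fg.
  + by rewrite !sat_not !S.
  + by split=> [/(_ 0)|H c]; rewrite sat_not S.
  + rewrite !sat_not => H H'; apply: H; move: H'.
    rewrite /shift !sat_subst; exact: (Pi1_down HM HA HkA).
- have [g [Fg mono gE up_g]] := IH En k.+1 ltac:(by move: HkA; rewrite /= !andbT).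
  (* The same [c] bounds the new witness and those inside [g]. Under the new quantifier the witness
     is variable 0 and the bound variable 1, whereas [g] expects the opposite order. *)
  pose swap n := if n is m.+1 then (if m is _.+1 then tVar n else tVar 0) else tVar 1.
  have sw M (v : nat -> dom M) x c : sat (scons x (scons c v)) (subst swap g) <->
      sat (scons c (scons x v)) g.
    rewrite sat_subst; set w := (fun n => _).
    suff -> : w = scons c (scons x v) by [].
    by apply: functional_extensionality; do 2?case.
  exists (fBAll (tVar 0) (subst swap g)); split=> [|v c c' cc'|v|M HM v].
  + by rewrite /=; apply: formula_of_subst Fg _; do 2?case.
  + move=> H x /= xc; apply/sw; apply: (mono _ _ _ cc'); apply/sw.
    by apply: H => /=; apply: leq_trans cc'.
  + rewrite sat_ex; split=> [H [x Hx]|H c x /= xc].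
      apply: (proj1 (gE (scons x v))) Hx => c.
      (* At the bound [maxn c x.+1] the quantifier reaches [x]; monotonicity then brings [g] back
         down to [c]. *)
      apply: (mono _ _ (maxn c x.+1)); first exact: leq_maxl.
      by apply/sw; apply: H => /=; apply: leq_maxr.
    by apply/sw; apply: (proj2 (gE (scons x v))) => Hx; apply: H; exists x.
  + have -> : v = scons (v 0) (fun n => v n.+1) by apply: functional_extensionality; case.
    move=> H x; rewrite -scons_num /= => /(lt_num_inv HM) [j jk ->].
    apply/sw; rewrite !scons_num; apply: up_g => //; apply/sw.
    exact: H.
Qed.

(** * Goedel's beta function in the standard model *)

Notation nsat := (@sat std_model).

Definition beta (a b i : nat) : nat := a %% (1 + (i + 1) * b).

Lemma sat_beta v a b i u :
  nsat v (fBeta a b i u) <->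
  @eval std_model v u = beta (@eval std_model v a) (@eval std_model v b) (@eval std_model v i).
Proof.
rewrite /fBeta sat_and sat_ex /= /beta; split.
- move=> [lt [q]]; rewrite !eval_tshift => ->.
  by rewrite modnMDl modn_small.
- move=> Eu; split; first by rewrite Eu ltn_mod add1n.
  exists (@eval std_model v a %/ (1 + (@eval std_model v i + 1) * @eval std_model v b)).
  rewrite !eval_tshift Eu; exact: divn_eq.
Qed.

(** A prime dividing both moduli divides [(j - i) * b] but not [b], for it would then divide 1. So
    it divides [j - i], is at most [n], and divides [b] through the factorial of [n], a
    contradiction. *)
Lemma beta_moduli_coprime n b i j : n`! %| b -> i < j <= n ->
  coprime (1 + (i + 1) * b) (1 + (j + 1) * b).
Proof.
move=> nb /andP [ij jn]; apply/eqP; set d := gcdn _ _.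
apply: contraTeq isT => d1.
have d0 : 0 < d by rewrite gcdn_gt0 add1n.
have d_gt1 : 1 < d by rewrite ltn_neqAle eq_sym d1.
have [p pp pd] := pdivP d_gt1.
have pi : p %| 1 + (i + 1) * b by apply: dvdn_trans pd (dvdn_gcdl _ _).
have pj : p %| 1 + (j + 1) * b by apply: dvdn_trans pd (dvdn_gcdr _ _).
have pb : ~~ (p %| b).
  apply/negP => /(dvdn_mull (i + 1)) H; move: pi; rewrite addnC dvdn_addr // dvdn1.
  by move=> /eqP p1; rewrite p1 in pp.
have : p %| (j - i) * b.
  have -> : (j - i) * b = (1 + (j + 1) * b) - (1 + (i + 1) * b).
    by rewrite subnDl -mulnBl subnDr.
  by rewrite dvdn_sub.
rewrite Euclid_dvdM // (negbTE pb) orbF => pji.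
case/negP: pb; apply: dvdn_trans nb; apply: dvdn_fact; rewrite prime_gt0 //=.
apply: leq_trans (dvdn_leq _ pji) _; lia.
Qed.

(** Chinese remainders, one modulus at a time: each new modulus is coprime to the product of the
    previous ones. *)
Lemma chinese_seq (m f : nat -> nat) k :
  (forall i j, i < j < k -> coprime (m i) (m j)) ->
  exists a, forall i, i < k -> a = f i %[mod m i].
Proof.
elim: k => [|k IH] co; first by exists 0.
have [i j /andP [ij jk]|a Ha] := IH; first by apply: co; rewrite ij ltnW.
have coP : coprime (\prod_(i < k) m i) (m k).
  apply: (big_ind (fun x => coprime x (m k))) => [|x y|i _]; first exact: coprime1n.
    by rewrite coprimeMl => -> ->.
  by apply: co; rewrite ltn_ord /=.
exists (chinese (\prod_(i < k) m i) (m k) a (f k)) => i.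
rewrite ltnS leq_eqVlt => /orP [/eqP ->|ik]; first by rewrite chinese_modr.
have dv : m i %| \prod_(i < k) m i.
  by rewrite (bigD1 (Ordinal ik)) //= dvdn_mulr.
rewrite -Ha // -(modn_dvdm _ dv) chinese_modl // modn_dvdm //.
Qed.

Lemma beta_complete (f : nat -> nat) n :
  exists a b, forall i, i <= n -> beta a b i = f i.
Proof.
(* [N] bounds the indices, so the moduli built from its factorial [b] are coprime; it also bounds
   the values [f i], which are thus smaller than the moduli and equal their own remainders. *)
pose N := n + \sum_(i < n.+1) f i; pose b := N`!.
have [i j /andP [ij jn]|a Ha] := @chinese_seq (fun i => 1 + (i + 1) * b) f n.+1.
  apply: (@beta_moduli_coprime N) => //; rewrite ij /=.
  by apply: leq_trans (leq_addr _ _); rewrite -ltnS.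
exists a, b => i ni; rewrite /beta Ha // modn_small //.
have : f i <= N.
  apply: leq_trans (leq_addl _ _).
  by rewrite (bigD1 (inord i : 'I_n.+1)) //= inordK // leq_addr.
have : N <= b by rewrite /b; elim: (N) => // k; rewrite factS; have := fact_gt0 k; nia.
nia.
Qed.

(** The trajectory of the iteration is coded by a beta pair, which makes the graph of an iterated
    function expressible in L_A. *)
Lemma beta_iter (f h : nat -> nat) x z : (forall n, f n.+1 = h (f n)) ->
  z = f x <-> exists a b, [/\ f 0 = beta a b 0,
    forall i, i < x -> exists2 u, u = beta a b i & h u = beta a b i.+1
    & z = beta a b x].
Proof.
move=> fS; split=> [->|[a [b [E0 ES ->]]]].
  have [a [b H]] := beta_complete f x; exists a, b; split; rewrite ?H //.
  by move=> i ix; exists (f i); rewrite H // ltnW.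
have : x <= x by []; elim: {-2}x => [|i IH] ix; first by rewrite E0.
by rewrite fS -IH ?(ltnW ix) //; have [u -> ->] := ES i ix.
Qed.

Lemma std_exp_total v : nsat v exp_total.
Proof.
apply/sat_all => x; apply/sat_all => y; apply/sat_ex; exists (x ^ y).
have [] := (@beta_iter (fun n => x ^ n) (fun u => u * x) y (x ^ y)).
  by move=> n; rewrite expnSr.
move=> /(_ erefl) [a [b [E0 ES Ez]]] _.
apply/sat_ex; exists a; apply/sat_ex; exists b; rewrite sat_and sat_beta sat_and sat_beta.
split; first by rewrite -E0 expn0.
split=> //; apply/sat_ball => i ix; have [u Eu Eh] := ES i ix.
by apply/sat_ex; exists u; rewrite sat_and !sat_beta /= addn1.
Qed.

Definition nat_structure (r : nat -> seq nat -> Prop) : structure :=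
  @Structure nat 0 1 addn muln (fun m n => m < n) r.

Lemma nat_structure_PAminus r : PAminus_model (nat_structure r).
Proof.
move=> A v.
do 17?[case=> [<-|] /=].
- by move=> x y z; rewrite addnA.
- by move=> x y; rewrite addnC.
- by move=> x y z; rewrite mulnA.
- by move=> x y; rewrite mulnC.
- by move=> x y z; rewrite mulnDr.
- by move=> x; rewrite addn0.
- by move=> x; rewrite muln0.
- by move=> x; rewrite muln1.
- by move=> x y z H1 H2; lia.
- by move=> x; rewrite ltnn.
- by move=> x y H1 H2; lia.
- by move=> x y z H; lia.
- by move=> x y z H1 H2; nia.
- by move=> x y H H'; apply: (H' (x - y)); lia.
- by [].
- by move=> x H1 H2; lia.
- by move=> x H1; lia.
- by [].
Qed.

Lemma num_nat r n : num (nat_structure r) n = n.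
Proof. by elim: n => //= n ->; rewrite addn1. Qed.

Lemma eval_nat r v t : @eval (nat_structure r) v t = @eval std_model v t.
Proof. by elim: t => //= t -> u ->. Qed.

Lemma sat_nat r k v A : formula_of L_A k A -> @sat (nat_structure r) v A <-> nsat v A.
Proof.
elim: A k v => //= [t u|t u|A IHA B IHB|A IH] k v; rewrite ?eval_nat //.
- by move=> /andP [HA HB]; rewrite (IHA k) // (IHB k).
- by move=> HA; split=> H d; apply/(IH k.+1 _ HA); apply: H.
Qed.

(** * Arithmetical relations *)

(** Definability in the standard model, stated for predicates on valuations so that closure lemmas
    take the place of explicit formulae. *)
Definition arith (k : nat) (P : (nat -> nat) -> Prop) : Prop :=
  exists2 F, formula_of L_A k F & forall v, nsat v F <-> P v.

Lemma arith_ext k P Q : (forall v, P v <-> Q v) -> arith k P -> arith k Q.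
Proof. by move=> E [F HF FE]; exists F => // v; rewrite FE. Qed.

Lemma arith_const k (Q : Prop) : arith k (fun=> Q).
Proof.
by case: (classic Q) => HQ; [exists (fNot fBot)|exists fBot] => // v; split=> // _ [].
Qed.

Lemma arith_imp k P Q : arith k P -> arith k Q -> arith k (fun v => P v -> Q v).
Proof.
move=> [F HF FE] [G HG GE]; exists (fImp F G); first by rewrite /= HF HG.
by move=> v /=; rewrite FE GE.
Qed.

Lemma arith_not k P : arith k P -> arith k (fun v => ~ P v).
Proof. by move=> H; apply: arith_imp H (arith_const _ _). Qed.

Lemma arith_and k P Q : arith k P -> arith k Q -> arith k (fun v => P v /\ Q v).
Proof.
move=> [F HF FE] [G HG GE]; exists (fAnd F G); first by rewrite /= HF HG.
by move=> v; rewrite sat_and FE GE.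
Qed.

Lemma arith_or k P Q : arith k P -> arith k Q -> arith k (fun v => P v \/ Q v).
Proof.
move=> [F HF FE] [G HG GE]; exists (fOr F G); first by rewrite /= HF HG.
by move=> v; rewrite sat_or FE GE.
Qed.

Lemma arith_all k P : arith k.+1 P -> arith k (fun v => forall d, P (scons d v)).
Proof.
move=> [F HF FE]; exists (fAll F) => // v.
by split=> H d; apply/FE; apply: H.
Qed.

Lemma arith_ex k P : arith k.+1 P -> arith k (fun v => exists d, P (scons d v)).
Proof.
move=> [F HF FE]; exists (fEx F); first by rewrite /= HF.
by move=> v; rewrite sat_ex; split=> -[d Hd]; exists d; apply/FE.
Qed.

Lemma arith_eq k t u : term_below k t -> term_below k u ->
  arith k (fun v => @eval std_model v t = @eval std_model v u).
Proof. by move=> Ht Hu; exists (fEq t u) => //=; rewrite Ht Hu. Qed.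

Lemma arith_lt k t u : term_below k t -> term_below k u ->
  arith k (fun v => @eval std_model v t < @eval std_model v u).
Proof. by move=> Ht Hu; exists (fLt t u) => //=; rewrite Ht Hu. Qed.

Lemma arith_subst k m P s : (forall n, n < k -> term_below m (s n)) ->
  arith k P -> arith m (fun v => P (fun n => @eval std_model v (s n))).
Proof.
move=> Hs [F HF FE]; exists (subst s F); first exact: formula_of_subst HF Hs.
by move=> v; rewrite sat_subst FE.
Qed.

Definition tpair (t u : term) : term := tAdd (tMul (tAdd t u) (tAdd t u)) t.

Lemma eval_tpair v t u :
  @eval std_model v (tpair t u) = npair (@eval std_model v t) (@eval std_model v u).
Proof. by rewrite /npair -mulnn. Qed.

Lemma eval_num_std v n : @eval std_model v (numeral n) = n.
Proof. by rewrite eval_numeral num_std. Qed.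

Lemma arith_iter (f h : nat -> nat) (t : term) (c : nat) :
  f 0 = c -> (forall n, f n.+1 = h (f n)) -> term_below 1 t ->
  (forall v, @eval std_model v t = h (v 0)) ->
  arith 2 (fun v => v 1 = f (v 0)).
Proof.
move=> f0 fS Ht tE.
(* The beta pair is variables 1 and 0, the argument and the value are 2 and 3. Inside the two inner
   quantifiers these move up by two, [u] being variable 0 and [i] variable 1. *)
exists (fEx (fEx (fAnd (fBeta (tVar 1) (tVar 0) tZero (numeral c))
  (fAnd (fBAll (tVar 2) (fEx (fAnd (fBeta (tVar 3) (tVar 2) (tVar 1) (tVar 0))
     (fBeta (tVar 3) (tVar 2) (tAdd (tVar 1) tOne) (tsubst (fun=> tVar 0) t)))))
   (fBeta (tVar 1) (tVar 0) (tVar 2) (tVar 3)))))).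
- have Hn : forall k, term_below k (tshift (numeral c)).
    by move=> k; apply: term_below_subst (term_below_numeral 0 c) _.
  have H6 : term_below 6 (tsubst (fun=> tVar 0) t) by apply: term_below_subst Ht _.
  have H7 : term_below 7 (tshift (tsubst (fun=> tVar 0) t)) by apply: term_below_subst H6 _.
  by rewrite /= !term_below_numeral !Hn H6 H7.
- move=> v; rewrite (beta_iter _ _ fS) f0 sat_ex.
  split=> [[a]|[a [b [E0 ES Ez]]]].
    rewrite sat_ex => -[b]; rewrite sat_and sat_beta sat_and sat_beta sat_ball eval_num_std.
    move=> [E0 [ES Ez]]; exists a, b; split=> // i /ES; rewrite sat_ex => -[u].
    by rewrite sat_and !sat_beta eval_tsubst tE /= addn1 => -[Eu Eh]; exists u.
  exists a; apply/sat_ex; exists b; rewrite sat_and sat_beta sat_and sat_beta sat_ball eval_num_std.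
  split=> //; split=> // i ix; have [u Eu Eh] := ES i ix; apply/sat_ex; exists u.
  by rewrite sat_and !sat_beta eval_tsubst tE /= addn1.
Qed.

(** * Diagonalisation *)

Definition numcode (n : nat) : nat := code_term (numeral n).

Definition tnumcode_step (t : term) : term :=
  tpair (numeral 3) (tpair t (tpair (numeral 2) (numeral 0))).

Lemma arith_numcode : arith 2 (fun v => v 1 = numcode (v 0)).
Proof.
apply: (@arith_iter numcode (fun c => npair 3 (npair c (npair 2 0)))
          (tnumcode_step (tVar 0)) (npair 1 0)) => //.
Qed.

(** Says that [B] holds of its own code. An equation takes the place of substitution, so that the
    code of the result is a polynomial in the codes of [B] and of its numeral. *)
Definition diagonal (B : form) : form :=
  fAll (fImp (fEq (tVar 0) (numeral (code B))) B).

(** The tags 5, 4 and 1 are those of [fAll], [fImp] and [fEq]; [npair 0 0] is the code of variable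
    0. *)
Definition diag (x z : nat) : nat :=
  npair 5 (npair 4 (npair (npair 1 (npair (npair 0 0) z)) x)).

Definition tdiag (x z : term) : term :=
  tpair (numeral 5) (tpair (numeral 4) (tpair (tpair (numeral 1)
    (tpair (tpair (numeral 0) (numeral 0)) z)) x)).

Lemma code_diagonal B : code (diagonal B) = diag (code B) (numcode (code B)).
Proof. by []. Qed.

Lemma eval_tdiag v x z :
  @eval std_model v (tdiag x z) = diag (@eval std_model v x) (@eval std_model v z).
Proof. by rewrite !eval_tpair !eval_num_std. Qed.

Lemma diagonal_formula_of L B : formula_of L 1 B -> sentence_of L (diagonal B).
Proof. by rewrite /sentence_of /= term_below_numeral. Qed.

Lemma sat_diagonal M (v : nat -> dom M) B :
  sat v (diagonal B) <-> sat (scons (num M (code B)) v) B.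
Proof.
split=> [|H d /=]; first by apply; rewrite /= eval_numeral.
by rewrite eval_numeral => ->.
Qed.

(** [B] says of [x] that [F] fails at the code of the diagonalisation of the formula with code [x];
    then [diagonal B] is a liar sentence. *)
Theorem Tarski_undefinability F : formula_of L_A 1 F ->
  ~ forall A, sentence_of L_A A -> forall v, nsat (fun=> code A) F <-> nsat v A.
Proof.
move=> HF T.
have [B HB BE] : arith 1 (fun v => forall z, z = numcode (v 0) -> ~ nsat (fun=> diag (v 0) z) F).
  apply: (@arith_ext 1 (fun v => forall z, scons z v 0 = numcode (scons z v 1) ->
     ~ nsat (fun n => @eval std_model (scons z v) (tdiag (tVar 1) (tVar 0))) F)).
    move=> v; split=> H z E; have := H z E; rewrite eval_tdiag //.
  apply: (@arith_all 1 (fun v => v 0 = numcode (v 1) ->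
     ~ nsat (fun n => @eval std_model v (tdiag (tVar 1) (tVar 0))) F)).
  apply: arith_imp.
    apply: (@arith_subst 2 2 _ (fun n => if n == 0 then tVar 1 else tVar 0)) arith_numcode.
    by case=> [|[]].
  apply: arith_not; exists (subst (fun=> tdiag (tVar 1) (tVar 0)) F).
    by apply: formula_of_subst HF _.
  by move=> v; rewrite sat_subst.
have := T (diagonal B) (diagonal_formula_of HB) (fun=> 0).
rewrite sat_diagonal BE code_diagonal num_std [scons _ _ 0]/=.
set X := nsat _ F; move=> E.
have nX : ~ X by move=> X1; move: (X1); rewrite {1}E => /(_ _ erefl).
by apply: (nX); apply/E => z ->.
Qed.

(** * Decoding *)

(** Numbers outside the range of [npair] are sent to the pair of zeros, so that [unpair_le1] and
    [unpair_le2] hold everywhere. *)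
Definition unpair (s : nat) : nat * nat :=
  match excluded_middle_informative (exists p : nat * nat, npair p.1 p.2 = s) with
  | left H => sval (constructive_indefinite_description _ H)
  | right _ => (0, 0)
  end.

Lemma unpairK x y : unpair (npair x y) = (x, y).
Proof.
rewrite /unpair; case: excluded_middle_informative => [H|[]]; last by exists (x, y).
case: constructive_indefinite_description => -[a b] /= /npair_inj [-> ->] //.
Qed.

Lemma unpair_spec s : (exists x y, s = npair x y /\ unpair s = (x, y)) \/
  ((forall x y, s <> npair x y) /\ unpair s = (0, 0)).
Proof.
case: (classic (exists x y, s = npair x y)) => [[x [y ->]]|N].
  by left; exists x, y; rewrite unpairK.
right; split=> [x y E|]; first by apply: N; exists x, y.
rewrite /unpair; case: excluded_middle_informative => // -[[x y] /= E].
by case: N; exists x, y.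
Qed.

Lemma npair_ge1 x y : x <= npair x y.
Proof. exact: leq_addl. Qed.

Lemma npair_ge2 x y : y <= npair x y.
Proof. rewrite /npair -mulnn; nia. Qed.

Lemma npair_gt2 x y : 0 < x -> y < npair x y.
Proof. rewrite /npair -mulnn; nia. Qed.

Lemma unpair_le1 s : (unpair s).1 <= s.
Proof. by have [[x [y [-> ->]]]|[_ ->]] := unpair_spec s; rewrite ?npair_ge1. Qed.

Lemma unpair_le2 s : (unpair s).2 <= s.
Proof. by have [[x [y [-> ->]]]|[_ ->]] := unpair_spec s; rewrite ?npair_ge2. Qed.

Lemma unpair_lt2 s : 0 < (unpair s).1 -> (unpair s).2 < s.
Proof.
have [[x [y [-> ->]]]|[_ ->]] := unpair_spec s; rewrite ?npair_ge2 //; exact: npair_gt2.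
Qed.

(** A code with a positive tag exceeds its argument, and only positive tags recurse, so fuel [n.+1]
    suffices to decode [n]. *)
Fixpoint decode_term_fuel (f n : nat) : term :=
  if f is f'.+1 then
    let a := (unpair n).2 in
    match (unpair n).1 with
    | 0 => tVar a
    | 1 => tZero
    | 2 => tOne
    | 3 => tAdd (decode_term_fuel f' (unpair a).1) (decode_term_fuel f' (unpair a).2)
    | 4 => tMul (decode_term_fuel f' (unpair a).1) (decode_term_fuel f' (unpair a).2)
    | _ => tZero
    end
  else tZero.

Lemma decode_term_fuelE f f' n : n < f -> n < f' -> decode_term_fuel f n = decode_term_fuel f' n.
Proof.
elim: f f' n => // f IH [//|f'] n nf nf' /=; have := @unpair_lt2 n.
case: (unpair n).1 => [|[|[|[|[|k]]]]] //= /(_ isT) lt;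
  have [l1 l2] := (unpair_le1 (unpair n).2, unpair_le2 (unpair n).2);
  by rewrite (IH f' (unpair (unpair n).2).1) ?(IH f' (unpair (unpair n).2).2) //; lia.
Qed.

Definition decode_term (n : nat) : term := decode_term_fuel n.+1 n.

Lemma decode_termE f n : n < f -> decode_term_fuel f n = decode_term n.
Proof. by move=> nf; apply: decode_term_fuelE. Qed.

Lemma decode_add t u : decode_term (npair 3 (npair t u)) = tAdd (decode_term t) (decode_term u).
Proof.
(* The fuel left after one step is given a name, which prevents its evaluation. *)
have [f Ef] : exists f, f = npair 3 (npair t u) by eexists.
rewrite {1}/decode_term -{1}Ef /= !unpairK /=.
have [H1 [H2 H3]] := (@npair_gt2 3 (npair t u) isT, (npair_ge1 t u, npair_ge2 t u)).
by rewrite !decode_termE //; lia.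
Qed.

Lemma decode_mul t u : decode_term (npair 4 (npair t u)) = tMul (decode_term t) (decode_term u).
Proof.
have [f Ef] : exists f, f = npair 4 (npair t u) by eexists.
rewrite {1}/decode_term -{1}Ef /= !unpairK /=.
have [H1 [H2 H3]] := (@npair_gt2 4 (npair t u) isT, (npair_ge1 t u, npair_ge2 t u)).
by rewrite !decode_termE //; lia.
Qed.

Lemma decode_var n : decode_term (npair 0 n) = tVar n.
Proof. by rewrite /decode_term /= unpairK. Qed.

Lemma decode_zero : decode_term (npair 1 0) = tZero.
Proof. by rewrite /decode_term; cbn [decode_term_fuel]; rewrite unpairK. Qed.

Lemma decode_one : decode_term (npair 2 0) = tOne.
Proof. by rewrite /decode_term; cbn [decode_term_fuel]; rewrite unpairK. Qed.

(* Relation symbols are decoded to [fBot]: only formulae of L_A matter. *)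
Fixpoint decode_fuel (f n : nat) : form :=
  if f is f'.+1 then
    let a := (unpair n).2 in
    match (unpair n).1 with
    | 1 => fEq (decode_term (unpair a).1) (decode_term (unpair a).2)
    | 2 => fLt (decode_term (unpair a).1) (decode_term (unpair a).2)
    | 4 => fImp (decode_fuel f' (unpair a).1) (decode_fuel f' (unpair a).2)
    | 5 => fAll (decode_fuel f' a)
    | _ => fBot
    end
  else fBot.

Lemma decode_fuelE f f' n : n < f -> n < f' -> decode_fuel f n = decode_fuel f' n.
Proof.
elim: f f' n => // f IH [//|f'] n nf nf' /=; have := @unpair_lt2 n.
case: (unpair n).1 => [|[|[|[|[|[|k]]]]]] //= /(_ isT) lt;
  have [l1 l2] := (unpair_le1 (unpair n).2, unpair_le2 (unpair n).2).
- by congr fImp; apply: IH; lia.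
- by congr fAll; apply: IH; lia.
Qed.

Definition decode (n : nat) : form := decode_fuel n.+1 n.

Lemma decodeE f n : n < f -> decode_fuel f n = decode n.
Proof. by move=> nf; apply: decode_fuelE. Qed.

Lemma decode_bot : decode (npair 0 0) = fBot.
Proof. by rewrite /decode /= unpairK. Qed.

Lemma decode_eq t u : decode (npair 1 (npair t u)) = fEq (decode_term t) (decode_term u).
Proof. by rewrite /decode [LHS]/= !unpairK. Qed.

Lemma decode_lt t u : decode (npair 2 (npair t u)) = fLt (decode_term t) (decode_term u).
Proof. by rewrite /decode [LHS]/= !unpairK. Qed.

Lemma decode_imp b c : decode (npair 4 (npair b c)) = fImp (decode b) (decode c).
Proof.
have [f Ef] : exists f, f = npair 4 (npair b c) by eexists.
rewrite {1}/decode -{1}Ef /= !unpairK /=.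
have [H1 [H2 H3]] := (@npair_gt2 4 (npair b c) isT, (npair_ge1 b c, npair_ge2 b c)).
by rewrite !decodeE //; lia.
Qed.

Lemma decode_all b : decode (npair 5 b) = fAll (decode b).
Proof.
have [f Ef] : exists f, f = npair 5 b by eexists.
rewrite {1}/decode -{1}Ef /= !unpairK /=.
by have H := @npair_gt2 5 b isT; rewrite decodeE //; lia.
Qed.

(** Repeated unpairing reads every number as an infinite sequence, so any number is a total
    assignment and no length is recorded. *)
Fixpoint assignment (s n : nat) : nat :=
  if n is m.+1 then assignment (unpair s).2 m else (unpair s).1.

Lemma assignment_cons d s : assignment (npair d s) = scons d (assignment s).
Proof. by apply: functional_extensionality => -[|n] /=; rewrite unpairK. Qed.

(** * Arithmetical definability of satisfaction for a single formula *)

Lemma arith_pair k t u w : term_below k t -> term_below k u -> term_below k w ->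
  arith k (fun v => @eval std_model v w = npair (@eval std_model v t) (@eval std_model v u)).
Proof.
move=> Ht Hu Hw; apply: (@arith_ext k (fun v => @eval std_model v w = @eval std_model v (tpair t u))).
  by move=> v; rewrite eval_tpair.
by apply: arith_eq; rewrite //= Ht Hu.
Qed.

Lemma arith_unpair : arith 3 (fun v => unpair (v 0) = (v 1, v 2)).
Proof.
apply: (@arith_ext 3 (fun v => v 0 = npair (v 1) (v 2) \/
   ((forall x y, v 0 <> npair x y) /\ (v 1 = 0 /\ v 2 = 0)))).
  move=> v; have [[x [y [E ->]]]|[N ->]] := unpair_spec (v 0).
    split=> [[E'|[/(_ x y) []] //]|[Ex Ey]]; last by left; rewrite -Ex -Ey.
    by move: E'; rewrite E => /npair_inj [-> ->].
  by split=> [[E|[_ [-> ->]]]|[<- <-]]; [case: (N _ _ E)| |right].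
apply: arith_or; first exact: (@arith_pair 3 (tVar 1) (tVar 2) (tVar 0)).
apply: arith_and.
  apply: (@arith_all 3 (fun v => forall y, v 1 <> npair (v 0) y)).
  apply: (@arith_all 4 (fun v => v 2 <> npair (v 1) (v 0))).
  apply: arith_not; exact: (@arith_pair 5 (tVar 1) (tVar 0) (tVar 2)).
apply: arith_and; first exact: (@arith_eq 3 (tVar 1) tZero).
exact: (@arith_eq 3 (tVar 2) tZero).
Qed.

Lemma arith_assignment n : arith 2 (fun v => v 1 = assignment (v 0) n).
Proof.
pose at3 (i j l m : nat) := match m with 0 => tVar i | 1 => tVar j | _ => tVar l end.
elim: n => [|n IH].
  apply: (@arith_ext 2 (fun v => exists y, unpair (v 0) = (v 1, y))).
    move=> v /=; split=> [[y ->] //|->]; exists (unpair (v 0)).2.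
    exact: surjective_pairing.
  apply: (@arith_ex 2 (fun v => unpair (v 1) = (v 2, v 0))).
  by apply: (@arith_subst 3 3 _ (at3 1 2 0)) arith_unpair; do 3?case.
apply: (@arith_ext 2 (fun v => exists s x, unpair (v 0) = (x, s) /\ v 1 = assignment s n)).
  move=> v /=; split=> [[s [x [-> ->]]] //|->]; exists (unpair (v 0)).2, (unpair (v 0)).1.
  by split=> //; exact: surjective_pairing.
apply: (@arith_ex 2 (fun v => exists x, unpair (v 1) = (x, v 0) /\ v 2 = assignment (v 0) n)).
apply: (@arith_ex 3 (fun v => unpair (v 2) = (v 0, v 1) /\ v 3 = assignment (v 1) n)).
apply: arith_and.
  by apply: (@arith_subst 3 4 _ (at3 2 0 1)) arith_unpair; do 3?case.
by apply: (@arith_subst 2 4 _ (at3 1 3 3)) IH; do 2?case.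
Qed.

Lemma arith_eval t : arith 2 (fun v => v 1 = @eval std_model (assignment (v 0)) t).
Proof.
pose at2 (i j m : nat) := match m with 0 => tVar i | _ => tVar j end.
(* The first premise says that [op] acts through the values of its arguments; sums and products then
   share one argument. *)
have bin op u w : (forall v x y, @eval std_model v (op x y) = @eval std_model (fun=> 0) (op (numeral (@eval std_model v x)) (numeral (@eval std_model v y)))) ->
   term_below 4 (op (tVar 1) (tVar 0)) ->
   arith 2 (fun v => v 1 = @eval std_model (assignment (v 0)) u) ->
   arith 2 (fun v => v 1 = @eval std_model (assignment (v 0)) w) ->
   arith 2 (fun v => v 1 = @eval std_model (assignment (v 0)) (op u w)).
  move=> opE Hop Hu Hw.
  apply: (@arith_ext 2 (fun v => exists y z, [/\ y = @eval std_model (assignment (v 0)) u,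
     z = @eval std_model (assignment (v 0)) w & v 1 = @eval std_model (scons z (scons y v)) (op (tVar 1) (tVar 0))])).
    move=> v; split=> [[y [z [Ey Ez ->]]]|E]; first by rewrite opE /= Ey Ez -opE.
    exists (@eval std_model (assignment (v 0)) u), (@eval std_model (assignment (v 0)) w).
    by split=> //; rewrite E opE [RHS]opE.
  apply: (@arith_ex 2 (fun v => exists z, [/\ v 0 = @eval std_model (assignment (v 1)) u,
     z = @eval std_model (assignment (v 1)) w & v 2 = @eval std_model (scons z v) (op (tVar 1) (tVar 0))])).
  apply: (@arith_ex 3 (fun v => [/\ v 1 = @eval std_model (assignment (v 2)) u,
     v 0 = @eval std_model (assignment (v 2)) w & v 3 = @eval std_model v (op (tVar 1) (tVar 0))])).
  apply: (@arith_ext 4 (fun v => v 1 = @eval std_model (assignment (v 2)) u /\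
     (v 0 = @eval std_model (assignment (v 2)) w /\ v 3 = @eval std_model v (op (tVar 1) (tVar 0))))).
    by move=> v; split=> [[? []]|[]].
  apply: arith_and; first by apply: (@arith_subst 2 4 _ (at2 2 1)) Hu; do 2?case.
  apply: arith_and; first by apply: (@arith_subst 2 4 _ (at2 2 0)) Hw; do 2?case.
  exact: (@arith_eq 4 (tVar 3)).
elim: t => [n| | |t IHt u IHu|t IHt u IHu].
- exact: arith_assignment.
- exact: (@arith_eq 2 (tVar 1) tZero).
- exact: (@arith_eq 2 (tVar 1) tOne).
- by apply: bin => // v x y /=; rewrite !eval_num_std.
- by apply: bin => // v x y /=; rewrite !eval_num_std.
Qed.

(** The defining formula is built by recursion on [A] outside the formula, and varies with [A], as
    Tarski's theorem requires. *)
Lemma arith_sat A : arith 1 (fun v => nsat (assignment (v 0)) A).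
Proof.
pose at2 (i j m : nat) := match m with 0 => tVar i | _ => tVar j end.
have atom t u R : arith 3 (fun v => R (v 1) (v 0)) ->
    arith 1 (fun v => R (@eval std_model (assignment (v 0)) t) (@eval std_model (assignment (v 0)) u)).
  move=> HR; apply: (@arith_ext 1 (fun v => exists y z, y = @eval std_model (assignment (v 0)) t /\
      (z = @eval std_model (assignment (v 0)) u /\ R y z))).
    move=> v; split=> [[y [z [-> [-> //]]]]|H].
    by eexists; eexists; do 2?split.
  apply: (@arith_ex 1 (fun v => exists z, v 0 = @eval std_model (assignment (v 1)) t /\
      (z = @eval std_model (assignment (v 1)) u /\ R (v 0) z))).
  apply: (@arith_ex 2 (fun v => v 1 = @eval std_model (assignment (v 2)) t /\
      (v 0 = @eval std_model (assignment (v 2)) u /\ R (v 1) (v 0)))).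
  apply: arith_and; first by apply: (@arith_subst 2 3 _ (at2 2 1)) (arith_eval t); do 2?case.
  by apply: arith_and => //; apply: (@arith_subst 2 3 _ (at2 2 0)) (arith_eval u); do 2?case.
elim: A => [|t u|t u|i ts|A IHA B IHB|A IH] /=.
- exact: arith_const.
- by apply: (atom t u (fun x y => x = y)); apply: (@arith_eq 3 (tVar 1) (tVar 0)).
- by apply: (atom t u (fun x y => x < y)); apply: (@arith_lt 3 (tVar 1) (tVar 0)).
- exact: arith_const.
- exact: arith_imp.
- apply: (@arith_ext 1 (fun v => forall d, nsat (assignment (npair d (v 0))) A)).
    by move=> v; split=> H d; have := H d; rewrite assignment_cons.
  apply: (@arith_all 1 (fun v => nsat (assignment (npair (v 0) (v 1))) A)).
  apply: (@arith_ext 2 (fun v => nsat (assignment (@eval std_model v (tpair (tVar 0) (tVar 1)))) A)).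
    by move=> v; rewrite eval_tpair.
  by apply: (@arith_subst 1 2 _ (fun=> tpair (tVar 0) (tVar 1))) IH.
Qed.

(** Unrelated formulae defining the [P m] are glued by a disjunction over the finitely many [m]
    below [c]. *)
Lemma arith_bounded k c (P : nat -> (nat -> nat) -> Prop) : (forall m, arith k.+1 (P m)) ->
  arith k.+1 (fun v => v 0 < c /\ P (v 0) v).
Proof.
move=> HP; elim: c => [|c IH].
  by apply: (@arith_ext _ (fun=> False)); [move=> v; split=> // -[]|apply: arith_const].
apply: (@arith_ext _ (fun v => (v 0 < c /\ P (v 0) v) \/ (v 0 = c /\ P c v))).
  move=> v; have -> : (v 0 < c.+1) = (v 0 == c) || (v 0 < c) by rewrite ltnS leq_eqVlt.
  split=> [[[-> H]|[E H]]|[/orP [/eqP E|lt] H]].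
  - by rewrite orbT.
  - by rewrite E eqxx.
  - by right; rewrite -E.
  - by left.
apply: arith_or IH (arith_and _ (HP c)).
apply: (@arith_ext _ (fun v => @eval std_model v (tVar 0) = @eval std_model v (numeral c))).
  by move=> v; rewrite eval_num_std.
by apply: arith_eq; rewrite // term_below_numeral.
Qed.

(** Replacing relation symbols by definitions of their interpretations translates formulae of the
    expansion into L_A. *)
Lemma arith_structure r L : (forall i m, arith m (fun v => r i (mkseq v m))) ->
  forall A k, formula_of L k A -> arith k (fun v => @sat (nat_structure r) v A).
Proof.
move=> Hr; elim=> [|t u|t u|i ts|A IHA B IHB|A IH] k /=.
- by move=> _; apply: arith_const.
- move=> /andP [Ht Hu]; apply: arith_ext (arith_eq Ht Hu) => v; by rewrite !eval_nat.
- move=> /andP [Ht Hu]; apply: arith_ext (arith_lt Ht Hu) => v; by rewrite !eval_nat.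
- move=> /andP [_ Hts].
  apply: (@arith_ext _ (fun v => r i (mkseq (fun n => @eval std_model v (nth tZero ts n)) (size ts)))).
    move=> v; set l1 := mkseq _ _; set l2 := map _ _; suff -> : l1 = l2 by [].
    rewrite /l2 -{1}(mkseq_nth tZero ts) /l1 /mkseq -map_comp; apply: eq_map => n /=.
    by rewrite eval_nat.
  apply: (@arith_subst (size ts) k _ (nth tZero ts)) (Hr i (size ts)) => n Hn.
  by apply: (all_nthP _ Hts).
- by move=> /andP [HA HB]; apply: arith_imp; auto.
- by move=> HA; apply: (@arith_all _ (fun v => @sat (nat_structure r) v A)); auto.
Qed.

(** * The diagonal theory *)

(** Intended readings: satisfaction, the graph of [numcode], and the value of a term. Languages add
    relation symbols only, hence graphs in place of functions. *)
Definition rSat (c s : term) : form := fRel 0 [:: c; s].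
Definition rNum (n z : term) : form := fRel 1 [:: n; z].
Definition rEval (t s x : term) : form := fRel 2 [:: t; s; x].

Definition truth_language : language := [:: (0, 2); (1, 2); (2, 3)].

(** Variable 0 of [g] receives the code under test, and variable 1 the code of the theory. *)
Definition guard (g : form) (x z c : term) : form := subst (scons c (fun=> tdiag x z)) g.

(* Variable [k.+1] is the code of the formula being diagonalised and variable 0
   the code of its numeral; so [tdiag] gives the code of the theory itself. *)
Definition guarded (g : form) (k : nat) (c : term) (A : form) : form :=
  fAlls k.+1 (fImp (rNum (tVar k.+1) (tVar 0))
    (fImp (guard g (tVar k.+1) (tVar 0) c) A)).

Section TheoryOfGuard.
Variable g : form.
Local Notation "# n" := (tVar n) (at level 1, n at level 0, format "# n").
Local Notation N := numeral.
Local Notation "A ==> B" := (fImp A B) (at level 55, right associativity).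

(* Assignments are coded as lists, with [npair d s] for [scons d s]. *)
Definition truth_axioms : seq form :=
  let var0 := tpair (N 0) (N 0) in
  let varS i := tpair (N 0) (tAdd i tOne) in
  let op k t u := tpair (N k) (tpair t u) in
  [:: rNum tZero (tpair (N 1) (N 0));
      fAlls 2 (rNum #0 #1 ==> rNum (tAdd #0 tOne) (tnumcode_step #1));
      guarded g 2 var0 (rEval var0 (tpair #1 #2) #1);
      guarded g 4 (varS #1)
        (rEval (tpair (N 0) #1) #2 #3 ==> rEval (varS #1) (tpair #4 #2) #3);
      guarded g 1 (tpair (N 1) (N 0)) (rEval (tpair (N 1) (N 0)) #1 tZero);
      guarded g 1 (tpair (N 2) (N 0)) (rEval (tpair (N 2) (N 0)) #1 tOne);
      guarded g 5 (op 3 #1 #2) (rEval #1 #3 #4 ==> rEval #2 #3 #5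
        ==> rEval (op 3 #1 #2) #3 (tAdd #4 #5));
      guarded g 5 (op 4 #1 #2) (rEval #1 #3 #4 ==> rEval #2 #3 #5
        ==> rEval (op 4 #1 #2) #3 (tMul #4 #5));
      guarded g 1 (tpair (N 0) (N 0)) (rSat (tpair (N 0) (N 0)) #1 ==> fBot);
      guarded g 5 (op 1 #1 #2) (rEval #1 #3 #4 ==> rEval #2 #3 #5
        ==> rSat (op 1 #1 #2) #3 ==> fEq #4 #5);
      guarded g 5 (op 1 #1 #2) (rEval #1 #3 #4 ==> rEval #2 #3 #5
        ==> fEq #4 #5 ==> rSat (op 1 #1 #2) #3);
      guarded g 5 (op 2 #1 #2) (rEval #1 #3 #4 ==> rEval #2 #3 #5
        ==> rSat (op 2 #1 #2) #3 ==> fLt #4 #5);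
      guarded g 5 (op 2 #1 #2) (rEval #1 #3 #4 ==> rEval #2 #3 #5
        ==> fLt #4 #5 ==> rSat (op 2 #1 #2) #3);
      guarded g 3 (op 4 #1 #2)
        (rSat (op 4 #1 #2) #3 ==> rSat #1 #3 ==> rSat #2 #3);
      guarded g 3 (op 4 #1 #2)
        ((rSat #1 #3 ==> rSat #2 #3) ==> rSat (op 4 #1 #2) #3);
      guarded g 2 (tpair (N 5) #1)
        (rSat (tpair (N 5) #1) #2 ==> fAll (rSat #2 (tpair #0 #3)));
      guarded g 2 (tpair (N 5) #1)
        (fAll (rSat #2 (tpair #0 #3)) ==> rSat (tpair (N 5) #1) #2);
      fAlls 2 (rSat #0 (tpair tZero #1)
        ==> fAll (rSat #1 (tpair #0 #2) ==> rSat #1 (tpair (tAdd #0 tOne) #2))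
        ==> fAll (rSat #1 (tpair #0 #2)))].

Definition conjunction (l : seq form) : form := foldr fAnd (fNot fBot) l.

(** Induction enters through one axiom on the sets defined by [rSat], so the list is finite.
    Variable 0 stays free, to receive the code of [base] itself by diagonalisation. *)
Definition base : form := conjunction (PAminus ++ exp_total :: truth_axioms).

Definition self_theory : form := diagonal base.
End TheoryOfGuard.

Lemma sat_conjunction M (v : nat -> dom M) l :
  sat v (conjunction l) <-> forall A, List.In A l -> sat v A.
Proof.
elim: l => [|A l IH]; first by split=> // _ [].
rewrite [conjunction _]/= sat_and IH; split=> [[HA Hl] B /= [<-|/Hl]|H] //.
by split=> [|B HB]; apply: H; [left|right].
Qed.

Lemma formula_of_conjunction L k l : formula_of L k (conjunction l) = all (formula_of L k) l.
Proof. by elim: l => //= A l ->; rewrite !andbT. Qed.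

Lemma formula_of_guarded g k c A : formula_of L_A 2 g -> term_below k.+2 c ->
  formula_of truth_language k.+2 A -> formula_of truth_language 1 (guarded g k c A).
Proof.
move=> Hg Hc HA; rewrite /guarded formula_of_fAlls addn1 /= ltnSn HA !andbT.
apply: (@formula_of_le L_A _ k.+2) => //; apply: formula_of_subst Hg _.
case=> [|[|n]] // _; by rewrite /= ltnSn.
Qed.

Lemma base_formula_of g : formula_of L_A 2 g -> formula_of truth_language 1 (base g).
Proof.
move=> Hg; rewrite /base formula_of_conjunction all_cat; apply/andP; split; first by [].
rewrite /truth_axioms; cbn [all].
by rewrite !formula_of_guarded.
Qed.

Lemma In_catl (T : Type) (x : T) l1 l2 : List.In x l1 -> List.In x (l1 ++ l2).
Proof. by elim: l1 => //= y l IH [->|/IH]; [left|right]. Qed.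

Lemma In_catr (T : Type) (x : T) l1 l2 : List.In x l2 -> List.In x (l1 ++ l2).
Proof. by elim: l1 => //= y l IH /IH; right. Qed.

Lemma In_cat (T : Type) (x : T) l1 l2 : List.In x (l1 ++ l2) -> List.In x l1 \/ List.In x l2.
Proof. by elim: l1 => [|y l IH] /=; [right|case=> [->|/IH []]; auto]. Qed.

Lemma In_nth (T : Type) (x0 : T) l i : i < size l -> List.In (nth x0 l i) l.
Proof. by elim: l i => // x l IH [|i] /=; [left|move/IH; right]. Qed.

(** The last entry of [ds] becomes variable 0, so [ds] lists the values of a block of quantifiers
    from the outermost in. *)
Definition push (D : Type) (v : nat -> D) (ds : seq D) : nat -> D :=
  foldl (fun u d => scons d u) v ds.

Lemma push_nth (D : Type) (v : nat -> D) ds j : push v ds (size ds + j) = v j.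
Proof.
elim: ds v j => //= d ds IH v j.
by have := IH (scons d v) j.+1; rewrite addnS.
Qed.

Lemma sat_fAllsP M (v : nat -> dom M) k A :
  sat v (fAlls k A) <-> forall ds, size ds = k -> sat (push v ds) A.
Proof.
elim: k v => [|k IH] v.
  by split=> [H [] //|/(_ [::] erefl)].
split=> [H [//|d ds] [Hs]|H]; first by apply: (proj1 (IH (scons d v)) _ ds Hs); apply: H.
by apply/sat_all => d; apply/IH => ds Hs; apply: (H (d :: ds)); rewrite /= Hs.
Qed.

(** * Models of the theory *)

Definition mpair (M : structure) (a b : dom M) : dom M :=
  i_add (i_mul (i_add a b) (i_add a b)) a.

Section TruthModel.
Variables (g : form) (M : structure) (n : nat) (v0 : nat -> dom M).
Hypothesis HB : sat (scons (num M n) v0) (base g).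
Hypothesis Hg : PAminus_model M ->
  forall c, sat (scons (num M c) (fun=> num M (diag n (numcode n)))) g.

Lemma model_PAminus : PAminus_model M.
Proof.
move=> A v HA; apply/(sat_sentence _ (scons (num M n) v0) (PAminus_sentence HA)).
by move/sat_conjunction: HB; apply; apply: In_catl.
Qed.

Lemma model_exp (v : nat -> dom M) : sat v exp_total.
Proof.
apply/(@sat_sentence L_A _ _ _ (scons (num M n) v0)) => //.
by move/sat_conjunction: HB; apply; apply: In_catr; left.
Qed.

Notation mSat c s := (@i_rel M 0 [:: c; s]).
Notation mNum i z := (@i_rel M 1 [:: i; z]).
Notation mEval t s x := (@i_rel M 2 [:: t; s; x]).
Notation "# n" := (num M n) (at level 1, format "# n").

Let ax i (Hi : i < size (truth_axioms g)) :
  sat (scons #n v0) (nth fBot (truth_axioms g) i).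
Proof. by move/sat_conjunction: HB; apply; apply: In_catr; right; apply: In_nth. Qed.

Lemma num_mpair a b : #(npair a b) = mpair #a #b.
Proof.
by rewrite /npair -mulnn !(num_add model_PAminus) (num_mul model_PAminus) !(num_add model_PAminus).
Qed.

Lemma mNum_numcode i : mNum #i #(numcode i).
Proof.
elim: i => [|i IH].
  have -> : numcode 0 = npair 1 0 by [].
  rewrite num_mpair; exact: (@ax 0 isT).
have -> : numcode i.+1 = npair 3 (npair (numcode i) (npair 2 0)) by [].
rewrite !num_mpair; exact: (@ax 1 isT _ _ IH).
Qed.

(** With [x] and [z] at their intended values, [tdiag] evaluates to the code of the theory, and the
    guard is an instance of [Hg]. *)
Lemma guardP (w : nat -> dom M) x z c m : eval w c = #m -> eval w x = #n -> eval w z = #(numcode n) ->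
  sat w (guard g x z c).
Proof.
move=> Ec Ex Ez; rewrite /guard sat_subst; set f := (fun i => _).
suff -> : f = scons #m (fun=> #(diag n (numcode n))) by apply: Hg; apply: model_PAminus.
apply: functional_extensionality => -[|i] //; rewrite /f [scons _ _ _]/=.
rewrite /diag !num_mpair -Ex -Ez.
have ev t u : eval w (tpair t u) = mpair (eval w t) (eval w u) by [].
by rewrite /tdiag !ev !eval_numeral.
Qed.

(** Discharges the guard of an axiom at a standard code [m]: the innermost quantifier receives the
    code of the numeral of [n], and [ds] fills the others. *)
Lemma axiom_guarded i k c A (Hi : i < size (truth_axioms g)) :
  nth fBot (truth_axioms g) i = guarded g k c A ->
  forall (ds : seq (dom M)) (m : nat), size ds = k ->
  let w := push (scons #n v0) (rcons ds #(numcode n)) in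
  eval w c = #m -> sat w A.
Proof.
move=> E ds m Hs w Ec.
have := @ax i Hi; rewrite E /guarded => /sat_fAllsP /(_ (rcons ds #(numcode n))).
rewrite size_rcons Hs -/(push _ _) -/w => /(_ erefl) /=.
have w0 : w 0 = #(numcode n) by rewrite /w /push foldl_rcons.
have wk : w k.+1 = #n by have := push_nth (scons #n v0) (rcons ds #(numcode n)) 0; rewrite size_rcons Hs addn0.
rewrite w0 wk; apply; first exact: mNum_numcode.
exact: (guardP Ec).
Qed.

(** Only the first [k] entries are constrained and the tail is any element, so every element codes
    an assignment for a sentence. *)
Fixpoint codes (k : nat) (s : dom M) (v : nat -> dom M) : Prop :=
  if k is j.+1 then exists2 s', s = mpair (v 0) s' & codes j s' (fun i => v i.+1)
  else True.

Lemma codes_ex k (v : nat -> dom M) : exists s, codes k s v.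
Proof.
elim: k v => [|k IH] v; first by exists #0.
by have [s Hs] := IH (fun i => v i.+1); exists (mpair (v 0) s), s.
Qed.

Lemma mEval_term k t s v : term_below k t -> codes k s v -> mEval #(code_term t) s (eval v t).
Proof.
move=> Ht Hs; elim: t Ht => [i|_|_|t IHt u IHu|t IHt u IHu].
(* A variable is looked up by walking down the code: one axiom reads the head, the next passes to
   the tail. *)
- rewrite /=; elim: k i s v Hs => // k IH [|i] _ v [s -> Hs] Hi.
    rewrite num_mpair; apply: (@axiom_guarded 2 2 _ _ isT erefl [:: s; v 0] (npair 0 0) erefl).
    by rewrite num_mpair.
  have -> : #(npair 0 i.+1) = mpair #0 (i_add #i (i_one M)) by rewrite num_mpair.
  apply: (@axiom_guarded 3 4 _ _ isT erefl [:: v 0; v i.+1; s; #i] (npair 0 i.+1) erefl).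
    by rewrite num_mpair.
  by have := IH i s (fun i => v i.+1) Hs Hi; rewrite num_mpair.
- rewrite [code_term _]/= num_mpair.
  apply: (@axiom_guarded 4 1 _ _ isT erefl [:: s] (npair 1 0) erefl); by rewrite num_mpair.
- rewrite [code_term _]/= num_mpair.
  apply: (@axiom_guarded 5 1 _ _ isT erefl [:: s] (npair 2 0) erefl); by rewrite num_mpair.
- move=> /andP [/IHt Ht /IHu Hu]; rewrite [code_term _]/= !num_mpair.
  apply: (@axiom_guarded 6 5 _ _ isT erefl [:: eval v u; eval v t; s; _; _]
    (npair 3 (npair (code_term t) (code_term u))) erefl _ Ht Hu); by rewrite !num_mpair.
- move=> /andP [/IHt Ht /IHu Hu]; rewrite [code_term _]/= !num_mpair.
  apply: (@axiom_guarded 7 5 _ _ isT erefl [:: eval v u; eval v t; s; _; _]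
    (npair 4 (npair (code_term t) (code_term u))) erefl _ Ht Hu); by rewrite !num_mpair.
Qed.

(** Standard formulae have standard codes, where every guard holds, so the Tarskian clauses apply at
    each subformula. Nonstandard [d] are covered too, as [mpair d s] codes [scons d v]. *)
Lemma mSat_form A k s v : formula_of L_A k A -> codes k s v ->
  mSat #(code A) s <-> sat v A.
Proof.
elim: A k s v => [|t u|t u|i ts|A IHA B IHB|A IH] k s v //; rewrite [code _]/= ?num_mpair.
- move=> _ _; split=> //.
  by apply: (@axiom_guarded 8 1 _ _ isT erefl [:: s] (npair 0 0) erefl); rewrite num_mpair.
- move=> /andP [Ht Hu] Hs.
  have [Et Eu] := (mEval_term Ht Hs, mEval_term Hu Hs); split.
  + apply: (@axiom_guarded 9 5 _ _ isT erefl [:: eval v u; eval v t; s; _; _]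
      (npair 1 (npair (code_term t) (code_term u))) erefl _ Et Eu); by rewrite !num_mpair.
  + apply: (@axiom_guarded 10 5 _ _ isT erefl [:: eval v u; eval v t; s; _; _]
      (npair 1 (npair (code_term t) (code_term u))) erefl _ Et Eu); by rewrite !num_mpair.
- move=> /andP [Ht Hu] Hs.
  have [Et Eu] := (mEval_term Ht Hs, mEval_term Hu Hs); split.
  + apply: (@axiom_guarded 11 5 _ _ isT erefl [:: eval v u; eval v t; s; _; _]
      (npair 2 (npair (code_term t) (code_term u))) erefl _ Et Eu); by rewrite !num_mpair.
  + apply: (@axiom_guarded 12 5 _ _ isT erefl [:: eval v u; eval v t; s; _; _]
      (npair 2 (npair (code_term t) (code_term u))) erefl _ Et Eu); by rewrite !num_mpair.
- move=> /andP [HA HB'] Hs; have EA := IHA _ _ _ HA Hs; have EB := IHB _ _ _ HB' Hs.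
  split=> [H /= /EA SA|/= H].
  + apply/EB; apply: (@axiom_guarded 13 3 _ _ isT erefl [:: s; _; _]
      (npair 4 (npair (code A) (code B))) erefl _ H SA); by rewrite !num_mpair.
  + apply: (@axiom_guarded 14 3 _ _ isT erefl [:: s; _; _]
      (npair 4 (npair (code A) (code B))) erefl _ _); first by rewrite !num_mpair.
    by move=> /EA /H /EB.
- move=> HA Hs.
  have EA d : mSat #(code A) (mpair d s) <-> sat (scons d v) A by apply: (IH k.+1) => //; exists s.
  split=> [H d|H].
  + apply/EA; apply: (@axiom_guarded 15 2 _ _ isT erefl [:: s; _] (npair 5 (code A)) erefl _ H).
    by rewrite num_mpair.
  + apply: (@axiom_guarded 16 2 _ _ isT erefl [:: s; _] (npair 5 (code A)) erefl _ _).
      by rewrite num_mpair.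
    by move=> d; apply/EA.
Qed.

Lemma mSat_sentence A (v : nat -> dom M) : sentence_of L_A A -> mSat #(code A) #0 <-> sat v A.
Proof. by move=> HA; apply: mSat_form HA _. Qed.

(** [mSat_form] turns the induction axiom at the code of [A] into induction for [A], with the
    parameters stored in [s]; this covers all formulae of L_A, not Delta_0 ones alone. *)
Lemma model_induction k A (v : nat -> dom M) : formula_of L_A k.+1 A -> sat v (fAlls k (induction_for A)).
Proof.
move=> HA; apply: sat_fAlls => {}v; have [s Hs] := codes_ex k v.
have EA d : mSat #(code A) (mpair d s) <-> sat (scons d v) A.
  by apply: mSat_form HA _; exists s.
rewrite /induction_for => /sat_inst /EA H0 HS.
move=> d; apply/EA; apply: (@ax 17 isT s #(code A) H0) => {}d /EA Hd.
apply/(EA (i_add d (i_one M))); 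
have : sat (scons d v) (subst (scons (tAdd (tVar 0) tOne) (fun j => tVar j.+1)) A) := HS d Hd.
rewrite sat_subst.
set f := (fun i => _); suff -> : f = scons (i_add d (i_one M)) v by [].
by apply: functional_extensionality; case.
Qed.

Lemma model_EA A (v : nat -> dom M) : EA A -> sat v A.
Proof.
case=> {A} [A HA|k A _ HA|].
- exact: model_PAminus.
- exact: model_induction.
- exact: model_exp.
Qed.

End TruthModel.

(** * Expansions of the standard model *)

Section StandardExpansion.
Variables (g : form) (n d : nat).
Hypotheses (Hg : formula_of L_A 2 g) (dE : d = diag n (numcode n)).

Definition allowed (c : nat) : Prop := nsat (scons c (fun=> d)) g.

Hypothesis allowed_le : forall b c, b <= c -> allowed c -> allowed b.

(** Satisfaction is cut off at the allowed codes, so that it concerns finitely many formulae as soon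
    as some code is refused. *)
Definition satisfies (c s : nat) : Prop := allowed c /\ nsat (assignment s) (decode c).

Definition evaluates (t s x : nat) : Prop :=
  allowed t /\ x = @eval std_model (assignment s) (decode_term t).

Definition truth_rel (i : nat) (ds : seq nat) : Prop :=
  match i, ds with
  | 0, [:: c; s] => satisfies c s
  | 1, [:: m; z] => z = numcode m
  | 2, [:: t; s; x] => evaluates t s x
  | _, _ => False
  end.

Definition std_truth : structure := nat_structure truth_rel.

Lemma sat_rSat (v : nat -> dom std_truth) c s :
  sat v (rSat c s) <-> satisfies (@eval std_model v c) (@eval std_model v s).
Proof. by rewrite -!(@eval_nat truth_rel). Qed.

Lemma sat_rNum (v : nat -> dom std_truth) x z :
  sat v (rNum x z) <-> @eval std_model v z = numcode (@eval std_model v x).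
Proof. by rewrite -!(@eval_nat truth_rel). Qed.

Lemma sat_rEval (v : nat -> dom std_truth) t s x :
  sat v (rEval t s x) <->
  evaluates (@eval std_model v t) (@eval std_model v s) (@eval std_model v x).
Proof. by rewrite -!(@eval_nat truth_rel). Qed.

Lemma sat_imp M (v : nat -> dom M) A B : sat v (fImp A B) <-> (sat v A -> sat v B).
Proof. by []. Qed.

(** Here [rNum] forces the innermost variable to be [numcode n], so the guard amounts to [allowed]
    at the value of [c]. *)
Lemma sat_guarded (v : nat -> dom std_truth) k c A :
  (forall w : nat -> dom std_truth, allowed (@eval std_model w c) -> sat w A) ->
  @sat std_truth (scons n v) (guarded g k c A).
Proof.
move=> H; apply/sat_fAllsP => ds Hs; set w := push _ _.
have wk : w k.+1 = n by rewrite -Hs -(addn0 (size ds)) /w push_nth.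
rewrite !sat_imp sat_rNum => Hz HG; apply: H; move: HG.
rewrite /guard sat_subst (sat_nat _ Hg); set f := (fun i => _).
suff -> : f = scons (@eval std_model w c) (fun=> d) by [].
apply: functional_extensionality => -[|i]; rewrite /f eval_nat //.
by rewrite [scons _ _ _]/= eval_tdiag Hz /= wk dE.
Qed.

Let simp := (sat_imp, sat_rEval, sat_rSat, sat_rNum, eval_tpair, eval_num_std).

Lemma std_truth_base (v : nat -> dom std_truth) : @sat std_truth (scons n v) (base g).
Proof.
apply/sat_conjunction => A HA; case: (In_cat HA) => {HA}.
  exact: nat_structure_PAminus.
(* Codes of immediate subformulae are smaller than the code of the formula, hence allowed along with
   it. *)
have sub k b c : allowed (npair k.+1 (npair b c)) -> allowed b /\ allowed c.
  have H := @npair_gt2 k.+1 (npair b c) isT.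
  by move=> Ha; split; apply: (allowed_le (leq_trans _ (ltnW H)) Ha);
    [apply: npair_ge1|apply: npair_ge2].
case=> [<-|]; first by apply/(@sat_nat _ 0) => //; apply: std_exp_total.
rewrite /truth_axioms; do 18?[case=> [<-|]]; last by [].
- by rewrite !simp.
- apply/sat_fAllsP => -[|z [|m [|]]] // _.
  by rewrite /tnumcode_step !simp /= => ->; rewrite addn1.
- apply: sat_guarded => w; rewrite !simp => Hc; split=> //.
  by rewrite decode_var assignment_cons.
- apply: sat_guarded => w; rewrite !simp => Hc [_ E]; split=> //.
  by move: E; rewrite assignment_cons /= addn1 !decode_var.
- apply: sat_guarded => w; rewrite !simp => Hc; split=> //.
  by rewrite decode_zero.
- apply: sat_guarded => w; rewrite !simp => Hc; split=> //.
  by rewrite decode_one.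
- apply: sat_guarded => w; rewrite !simp => Hc [_ E1] [_ E2]; split=> //.
  by rewrite decode_add /= -E1 -E2.
- apply: sat_guarded => w; rewrite !simp => Hc [_ E1] [_ E2]; split=> //.
  by rewrite decode_mul /= -E1 -E2.
- by apply: sat_guarded => w; rewrite !simp => Hc [_]; rewrite decode_bot.
- apply: sat_guarded => w; rewrite !simp => Hc [_ E1] [_ E2] [_].
  by rewrite decode_eq /= -E1 -E2.
- apply: sat_guarded => w; rewrite !simp => Hc [_ E1] [_ E2] E; split=> //.
  by move: E; rewrite decode_eq /= -E1 -E2.
- apply: sat_guarded => w; rewrite !simp => Hc [_ E1] [_ E2] [_].
  by rewrite decode_lt /= -E1 -E2.
- apply: sat_guarded => w; rewrite !simp => Hc [_ E1] [_ E2] E; split=> //.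
  by move: E; rewrite decode_lt /= -E1 -E2.
- apply: sat_guarded => w; rewrite !simp => /sub [Hb Hc] [_].
  by rewrite decode_imp => H [_ Sb]; split=> //; apply: H.
- apply: sat_guarded => w; rewrite !simp => Hbc H; split=> //.
  have [Hb Hc] := sub _ _ _ Hbc.
  by rewrite decode_imp => Sb; have [] := H (conj Hb Sb).
- apply: sat_guarded => w; rewrite !simp => Hb [_]; rewrite decode_all => H a.
  apply/sat_rSat; rewrite eval_tpair; split; last by rewrite assignment_cons; apply: H.
  by apply: allowed_le Hb; apply: npair_ge2.
- apply: sat_guarded => w; rewrite !simp => Hb H; split=> //.
  rewrite decode_all => a; have /sat_rSat := H a; rewrite eval_tpair => -[_].
  by rewrite assignment_cons.
- apply/sat_fAllsP => -[|s [|c [|]]] // _; set w := push _ _.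
  apply/sat_imp => H0; apply/sat_imp => /sat_all HS; apply/sat_all.
  (* The truncated relation obeys induction as any set of natural numbers does. *)
  elim=> [|x IH]; first exact: H0.
  by have /sat_imp /(_ IH) := HS x; rewrite !sat_rSat !eval_tpair /= addn1.
Qed.
End StandardExpansion.

(** * The two cases: all guards hold, or some guard fails *)

Lemma code_self_theory g :
  code (self_theory g) = diag (code (base g)) (numcode (code (base g))).
Proof. exact: code_diagonal. Qed.

(* The codes are kept abstract below, to prevent their evaluation. *)
Lemma std_truth_self_theory g d : d = code (self_theory g) -> formula_of L_A 2 g ->
  (forall b c, b <= c -> allowed g d c -> allowed g d b) ->
  forall v : nat -> dom (std_truth g d), sat v (self_theory g).
Proof.
rewrite code_self_theory => Ed Hg mono v.
rewrite /self_theory sat_diagonal num_nat; move: (code _) Ed => n Ed.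
exact: std_truth_base.
Qed.

(** Every model of the sentence then obeys the Tarskian clauses at standard codes, so EA and the
    biconditionals hold in it and are derivable by completeness. The standard expansion gives
    consistency. *)
Theorem DEF_self_theory g d : d = code (self_theory g) -> formula_of L_A 2 g ->
  (forall M, PAminus_model M -> forall v, nsat v g -> sat (fun n => num M (v n)) g) ->
  (forall c, allowed g d c) -> DEF (self_theory g).
Proof.
move=> Ed Hg g_up Hall; exists truth_language.
have hyp M (v : nat -> dom M) : sat v (self_theory g) -> exists n,
    sat (scons (num M n) v) (base g) /\
    (PAminus_model M ->
     forall c, sat (scons (num M c) (fun=> num M (diag n (numcode n)))) g).
  move: Ed; rewrite code_self_theory /self_theory sat_diagonal.
  move: (code _) => n Ed HB; exists n; split=> // HM c.
  (* Upward absoluteness carries the guards from the standard model to [M]. *)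
  have := g_up M HM _ (Hall c); rewrite -Ed; congr (sat _ _).
  by rewrite -(@scons_num M c (fun=> d)).
have prv C : (forall M (v : nat -> dom M), sat v (self_theory g) -> sat v C) ->
    proves (fun B => B = self_theory g) C.
  move=> H; exists [:: self_theory g]; split; first by move=> B [<-|[]].
  exact: completeness.
split.
- move=> _ ->; apply: diagonal_formula_of; exact: base_formula_of.
- move=> [G [HG D]].
  apply: (@soundness _ _ D (std_truth g d) (fun=> 0)) => B /HG ->.
  exact (@std_truth_self_theory g d Ed Hg (fun b _ _ _ => Hall b) (fun=> 0)).
- move=> A HA; apply: prv => M v /hyp [n [HB Hc]]; exact: (model_EA HB Hc).
(* The satisfaction of a sentence does not depend on the assignment, so the one coded by zero
   serves. *)
- exists (rSat (tVar 0) tZero) => // A HA; apply: prv => M v /hyp [n [HB Hc]].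
  rewrite sat_iff sat_inst eval_numeral.
  exact: (mSat_sentence HB Hc).
Qed.

(** No code from [c0] on is allowed, so the relations of the standard expansion are definable in
    L_A, and so is the set given there by a truth formula [Theta], against Tarski's theorem. *)
Theorem not_DEF_self_theory g d c0 : d = code (self_theory g) -> formula_of L_A 2 g ->
  (forall b c, b <= c -> allowed g d c -> allowed g d b) ->
  ~ allowed g d c0 -> ~ DEF (self_theory g).
Proof.
move=> Ed Hg mono Nc0 [L [_ _ _ [Theta HT T]]].
have lt_c0 c : allowed g d c -> c < c0.
  by move=> Hc; rewrite ltnNge; apply/negP => /mono /(_ Hc).
have Hr i m : arith m (fun v => truth_rel g d i (mkseq v m)).
  case: i m => [|[|[|i]]] [|[|[|[|m]]]]; try exact: arith_const.
  - pose P c (v : nat -> nat) := allowed g d c /\ nsat (assignment (v 1)) (decode c).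
    apply: (@arith_ext 2 (fun v => v 0 < c0 /\ P (v 0) v)).
      by move=> v; split=> [[_ //]|H]; split=> //; apply: lt_c0; case: H.
    apply: arith_bounded => c; apply: arith_and; first exact: arith_const.
    by apply: (@arith_subst 1 2 _ (fun=> tVar 1)) (arith_sat (decode c)).
  - exact: arith_numcode.
  - pose P c (v : nat -> nat) := allowed g d c /\
      v 2 = @eval std_model (assignment (v 1)) (decode_term c).
    apply: (@arith_ext 3 (fun v => v 0 < c0 /\ P (v 0) v)).
      by move=> v; split=> [[_ //]|H]; split=> //; apply: lt_c0; case: H.
    apply: arith_bounded => c; apply: arith_and; first exact: arith_const.
    apply: (@arith_subst 2 3 _ (fun n => tVar n.+1)) (arith_eval (decode_term c)).
    by do 2?case.
have [F HF FE] := arith_structure Hr HT.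
apply: (Tarski_undefinability HF) => A HA v.
have [G [HG D]] := T A HA.
have : @sat (std_truth g d) v (fIff (inst Theta (numeral (code A))) A).
  apply: (soundness D) => B /HG ->; exact (@std_truth_self_theory g d Ed Hg mono v).
rewrite sat_iff sat_inst eval_numeral num_nat (sat_nat _ HA) => <-.
by rewrite FE; apply: (sat_below HT) => -[].
Qed.

Theorem mainTheorem2 :
  ~ exists sigma : form,
      [/\ formula_of L_A 1 sigma,
          Sigma 2 sigma
        & forall n : nat,
            @sat std_model (fun _ => n) sigma <->
            exists A : form, DEF A /\ n = code A].
Proof.
move=> [sigma [Hs S2 HD]].
have [g [Hg mono gE g_up]] := Sigma2_approximants S2 Hs.
have [d Ed] : exists d, d = code (self_theory g) by eexists.
have E := gE (fun=> d); have [Hn|Nn] := classic (nsat (fun=> d) sigma).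
- have [A [DA EA]] := proj1 (HD d) Hn.
  have AE : A = self_theory g by apply: code_inj; rewrite -EA.
  case: (classic (exists c, ~ allowed g d c)) => [[c Hc]|N].
    apply: (not_DEF_self_theory Ed Hg _ Hc); last by rewrite -AE.
    by move=> b c'; apply: mono.
  (* Were every code allowed, [gE] would make [sigma] false at [d]. *)
  by apply: (proj1 E) => // c; apply: NNPP => Hc; apply: N; exists c.
- apply: (Nn); apply/HD; exists (self_theory g); split=> //.
  by apply: (DEF_self_theory Ed) => // c; apply: (proj2 E).
Qed.
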